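(* Let $f(z) = z + a_2 z^2 + a_3 z^3 + \cdots$ belong to $\mathcal{C}_e$. Then $$|a_2a_3-a_4|\le\frac{1}{12}.$$ The inequality is sharp, i.e. equality holds for some function in $\mathcal{C}_e$.
   Context: $\mathbb{D}=\{z\in\mathbb{C}:|z|<1\}$. $\mathcal{S}$ is the class of univalent analytic functions $f$ on $\mathbb{D}$ with $f(0)=0$, $f'(0)=1$, written $f(z)=z+\sum_{n\ge2}a_nz^n$. For analytic $g,h$ on $\mathbb{D}$, $g\prec h$ (subordination) means that there is an analytic $\omega:\mathbb{D}\to\mathbb{D}$ with $\omega(0)=0$ and $g(z)=h(\omega(z))$ for $z\in\mathbb{D}$. The class $\mathcal{C}_e$ is $$\mathcal{C}_e=\left\{f\in\mathcal{S}:\ 1+\frac{zf''(z)}{f'(z)}\prec e^z,\ z\in\mathbb{D}\right\}.$$ *)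

(* Defs.v *)
From Stdlib Require Import Reals.
From Coquelicot Require Import Coquelicot.

Local Open Scope R_scope.
Local Open Scope C_scope.

Definition in_disk (z : C) : Prop := (Cmod z < 1)%R.

(* Analytic means complex differentiable at every point of the open disk;
   functions are total on C and their values off the disk are irrelevant. *)
Definition analytic_on_disk (g : C -> C) : Prop :=
  forall z : C, in_disk z -> ex_derive (K := C_AbsRing) (V := C_NormedModule) g z.

Definition univalent_on_disk (g : C -> C) : Prop :=
  forall z w : C, in_disk z -> in_disk w -> g z = g w -> z = w.

Definition class_S (f : C -> C) : Prop :=
  analytic_on_disk f /\ univalent_on_disk f /\ f 0 = 0 /\ C_derive f 0 = 1.

Definition subordinate (g h : C -> C) : Prop :=
  exists omega : C -> C,
    analytic_on_disk omega /\
    (forall z : C, in_disk z -> in_disk (omega z)) /\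
    omega 0 = 0 /\
    (forall z : C, in_disk z -> g z = h (omega z)).

Definition Cexp (z : C) : C := (exp (Re z) * cos (Im z), exp (Re z) * sin (Im z))%R.

(* The quotient is a genuine one on the disk when f is in S: a univalent
   analytic function has no critical points. *)
Definition class_Ce (f : C -> C) : Prop :=
  class_S f /\
  subordinate (fun z => 1 + z * C_derive (C_derive f) z / C_derive f z) Cexp.

(* For f in S the normalisation forces a 0 = 0 and a 1 = 1. *)
Definition power_series_on_disk (f : C -> C) (a : nat -> C) : Prop :=
  forall z : C, in_disk z -> is_pseries (K := C_AbsRing) (V := C_NormedModule) a z (f z).

(* Main.v *)
Require Import Defs.
From Stdlib Require Import Reals.
From Coquelicot Require Import Coquelicot.
From Stdlib Require Import Lra Lia Psatz Factorial Arith.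

(** Write 1 + z f''/f' = e^omega with a Schwarz function
omega = c1 z + c2 z^2 + c3 z^3 + O(z^4). Comparing coefficients gives
c1 = 2 a2, c2 = 6 a3 - 6 a2^2, c3 = 12 a4 - 30 a2 a3 + (56/3) a2^3, and hence
a2 a3 - a4 = - (c3 + (3/2) c1 c2 - c1^3 / 12) / 12. The inequality therefore says
that |c3 + (3/2) c1 c2 - c1^3 / 12| <= 1 for every Schwarz function.

This follows from two classical estimates, |c2| <= 1 - |c1|^2 and
|c3| <= 1 - |c1|^2 - |c2|^2 / (1 + |c1|), by the triangle inequality and a
discussion of a real polynomial ([schwarz_moduli_bound]). Both estimates come from
one fact ([toeplitz_contraction]): the lower triangular Toeplitz matrix with entries
c1, c2, c3 is a contraction. Indeed, for a polynomial p of degree at most 2,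
split omega p = q + H with q the Taylor polynomial of degree 3 and H = O(z^4). On the
circle of radius r the remainder H is orthogonal to q, so the mean of |q|^2 is at
most that of |omega p|^2, which is at most that of |p|^2; then r tends to 1.

The orthogonality, as well as the evaluation of the means of |p|^2 and |q|^2, is an
instance of the mean value property in the form of [circle_integral_zero]: a
holomorphic function on the punctured disk that tends to 0 at the origin has zero
mean over circles. It is proved by differentiating under the integral sign, which
needs a continuous derivative. The definition of the class provides for omega mere
complex differentiability; but e^omega is a quotient of power series, because f' has
no zeros ([nonvanishing_of_Re_log_derivative]), so omega is in fact twice
differentiable ([class_Ce_schwarz_function]).

Equality holds for omega = z^3, that is, f' = D(z^3) with 3 u D' = D (e^u - 1) and
D(0) = 1. The coefficients of D are defined by the recursion that this differential
equation imposes. They are nonnegative and their sum over positive indices is at most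
2/3, so that Re f' > 0 on the disk and f is univalent by the Noshiro-Warschawski
criterion ([univalent_of_Re_derive_pos]). Here a2 = a3 = 0 and a4 = 1/12. *)

Local Open Scope R_scope.
Local Open Scope C_scope.

(** * Complex derivatives and their restriction to curves *)

Definition is_Cderive (f : C -> C) (z d : C) : Prop :=
  @is_derive C_AbsRing C_NormedModule f z d.

Lemma is_Cderive_eps (f : C -> C) (z d : C) :
  is_Cderive f z d <->
  (forall eps : R, (0 < eps)%R -> exists delta : R, (0 < delta)%R /\
     forall w : C, (Cmod (w - z) < delta)%R ->
       (Cmod (f w - f z - (w - z) * d) <= eps * Cmod (w - z))%R).
Proof.
split.
- intros [_ H] eps Heps.
  destruct (H z (fun P HP => HP) (mkposreal eps Heps)) as [del Hdel].
  exists del; split; [apply cond_pos|].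
  intros w Hw. exact (Hdel w Hw).
- intros H; split.
  + apply (@is_linear_scal_l C_AbsRing C_NormedModule).
  + intros x Hx.
    assert (E : z = x) by exact (@is_filter_lim_locally_unique C_AbsRing
      (AbsRing_NormedModule C_AbsRing) z x Hx).
    rewrite <- E. intros eps.
    destruct (H eps (cond_pos eps)) as [del [Hdel K]].
    exists (mkposreal del Hdel). intros w Hw. exact (K w Hw).
Qed.

Lemma is_Cderive_quadratic (f : C -> C) (z d : C) (M delta : R) :
  (0 < delta)%R ->
  (forall w : C, (Cmod (w - z) < delta)%R ->
     (Cmod (f w - f z - (w - z) * d) <= M * Cmod (w - z) ^ 2)%R) ->
  is_Cderive f z d.
Proof.
intros Hd H. apply is_Cderive_eps. intros eps Heps.
assert (HM : (0 < Rabs M + 1)%R) by (pose proof (Rabs_pos M); lra).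
exists (Rmin delta (eps / (Rabs M + 1))). split.
- apply Rmin_glb_lt; [lra|]. apply Rdiv_lt_0_compat; lra.
- intros w Hw.
  pose proof (Rmin_l delta (eps / (Rabs M + 1))).
  pose proof (Rmin_r delta (eps / (Rabs M + 1))).
  apply Rle_trans with (1 := H w ltac:(lra)).
  pose proof (Cmod_ge_0 (w - z)) as Hp.
  replace (M * Cmod (w - z) ^ 2)%R with ((M * Cmod (w - z)) * Cmod (w - z))%R by ring.
  apply Rmult_le_compat_r; [lra|].
  apply Rle_trans with ((Rabs M + 1) * (eps / (Rabs M + 1)))%R.
  2: right; field; lra.
  pose proof (Rle_abs M). nra.
Qed.

Lemma is_Cderive_const (c z : C) : is_Cderive (fun _ => c) z 0.
Proof. apply (@is_derive_const C_AbsRing C_NormedModule). Qed.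

Lemma is_Cderive_id (z : C) : is_Cderive (fun w => w) z 1.
Proof.
apply is_Cderive_quadratic with (M := 0%R) (delta := 1%R); [lra|].
intros w _. replace (w - z - (w - z) * 1) with (RtoC 0) by ring. rewrite Cmod_0. lra.
Qed.

Lemma is_Cderive_plus (f g : C -> C) (z df dg : C) :
  is_Cderive f z df -> is_Cderive g z dg -> is_Cderive (fun w => f w + g w) z (df + dg).
Proof. apply (@is_derive_plus C_AbsRing C_NormedModule). Qed.

(** The complex numbers carry two normed module structures over themselves, with equal
    norms but different uniform structures. The product rule concerns multiplication
    in the one derived from the absolute value, and this equivalence transports it. *)
Lemma is_Cderive_abs_iff (f : C -> C) (z d : C) :
  is_Cderive f z d <-> @is_derive C_AbsRing (AbsRing_NormedModule C_AbsRing) f z d.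
Proof.
rewrite is_Cderive_eps. split.
- intros H; split.
  + apply (@is_linear_scal_l C_AbsRing (AbsRing_NormedModule C_AbsRing)).
  + intros x Hx.
    assert (E : z = x) by exact (@is_filter_lim_locally_unique C_AbsRing
      (AbsRing_NormedModule C_AbsRing) z x Hx).
    rewrite <- E. intros eps.
    destruct (H eps (cond_pos eps)) as [del [Hdel K]].
    exists (mkposreal del Hdel). intros w Hw. exact (K w Hw).
- intros [_ H] eps Heps.
  destruct (H z (fun P HP => HP) (mkposreal eps Heps)) as [del Hdel].
  exists del; split; [apply cond_pos|].
  intros w Hw. exact (Hdel w Hw).
Qed.

Lemma is_Cderive_mult (f g : C -> C) (z df dg : C) :
  is_Cderive f z df -> is_Cderive g z dg -> is_Cderive (fun w => f w * g w) z (df * g z + f z * dg).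
Proof.
rewrite !is_Cderive_abs_iff. intros Hf Hg.
apply (@is_derive_mult C_AbsRing f g z df dg Hf Hg). intros n m; apply Cmult_comm.
Qed.

Lemma is_Cderive_comp (f g : C -> C) (z df dg : C) :
  is_Cderive f (g z) df -> is_Cderive g z dg -> is_Cderive (fun w => f (g w)) z (dg * df).
Proof.
rewrite (is_Cderive_abs_iff g). intros Hf Hg.
apply (@is_derive_comp C_AbsRing C_NormedModule f g z df dg Hf Hg).
Qed.

Lemma is_Cderive_congr (f : C -> C) (z d e : C) : d = e -> is_Cderive f z d -> is_Cderive f z e.
Proof. intros ->; trivial. Qed.

Lemma is_Cderive_ext_loc (f g : C -> C) (z d : C) (delta : R) :
  (0 < delta)%R -> (forall w, (Cmod (w - z) < delta)%R -> f w = g w) ->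
  is_Cderive f z d -> is_Cderive g z d.
Proof.
intros Hd H. apply is_derive_ext_loc.
exists (mkposreal delta Hd). intros w Hw. exact (H w Hw).
Qed.

Lemma is_Cderive_unique (f : C -> C) (z d e : C) : is_Cderive f z d -> is_Cderive f z e -> d = e.
Proof.
intros H K. rewrite <- (is_C_derive_unique f z d H). apply is_C_derive_unique, K.
Qed.

Lemma is_Cderive_continuous (f : C -> C) (z d : C) :
  is_Cderive f z d -> forall eps : R, (0 < eps)%R -> exists delta : R, (0 < delta)%R /\
  forall w, (Cmod (w - z) < delta)%R -> (Cmod (f w - f z) < eps)%R.
Proof.
intros H eps Heps. destruct (proj1 (is_Cderive_eps f z d) H 1%R Rlt_0_1) as [del [Hdel K]].
pose proof (Cmod_ge_0 d) as Hd0.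
exists (Rmin del (eps / (2 + Cmod d))). split.
- apply Rmin_glb_lt; [lra|]. apply Rdiv_lt_0_compat; lra.
- intros w Hw.
  pose proof (Rmin_l del (eps / (2 + Cmod d))).
  pose proof (Rmin_r del (eps / (2 + Cmod d))).
  replace (f w - f z) with ((f w - f z - (w - z) * d) + (w - z) * d) by ring.
  apply Rle_lt_trans with (1 := Cmod_triangle _ _).
  rewrite Cmod_mult. specialize (K w ltac:(lra)).
  assert (Cmod (w - z) * (2 + Cmod d) < eps)%R.
  { apply Rlt_le_trans with ((eps / (2 + Cmod d)) * (2 + Cmod d))%R; [|right; field; lra].
    apply Rmult_lt_compat_r; lra. }
  pose proof (Cmod_ge_0 (w - z)). nra.
Qed.

Lemma Cmod_triangle_inv (a b : C) : (Cmod a - Cmod b <= Cmod (a - b))%R.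
Proof.
pose proof (Cmod_triangle (a - b) b). replace (a - b + b) with a in H by ring. lra.
Qed.

Lemma is_Cderive_inv_id (z : C) : z <> 0 -> is_Cderive (fun w => / w) z (- / (z * z)).
Proof.
intros Hz. pose proof (proj1 (Cmod_gt_0 z) Hz) as Hm.
apply is_Cderive_quadratic with (M := (2 / Cmod z ^ 3)%R) (delta := (Cmod z / 2)%R); [lra|].
intros w Hw.
assert (Hwm : (Cmod z / 2 <= Cmod w)%R).
{ pose proof (Cmod_triangle_inv z w).
  replace (z - w) with (- (w - z)) in H by ring. rewrite Cmod_opp in H. lra. }
assert (Hw0 : w <> 0) by (apply Cmod_gt_0; lra).
replace (/ w - / z - (w - z) * - / (z * z)) with ((w - z) * (w - z) * / (w * (z * z))).
2: field; auto.
rewrite !Cmod_mult, Cmod_inv, !Cmod_mult.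
2: repeat apply Cmult_neq_0; auto.
replace (2 / Cmod z ^ 3 * Cmod (w - z) ^ 2)%R with (Cmod (w - z) * Cmod (w - z) * (2 / Cmod z ^3))%R by ring.
apply Rmult_le_compat_l; [apply Rmult_le_pos; apply Cmod_ge_0|].
replace (2 / Cmod z ^ 3)%R with (/ (Cmod z / 2 * (Cmod z * Cmod z)))%R by (field; lra).
apply Rinv_le_contravar.
- repeat apply Rmult_lt_0_compat; lra.
- apply Rmult_le_compat_r; [|lra]. nra.
Qed.

Lemma is_Cderive_inv (f : C -> C) (z d : C) :
  f z <> 0 -> is_Cderive f z d -> is_Cderive (fun w => / f w) z (- d / (f z * f z)).
Proof.
intros Hf H. apply is_Cderive_congr with (d * (- / (f z * f z))).
- field; auto.
- apply (is_Cderive_comp (fun w => / w) f); auto using is_Cderive_inv_id.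
Qed.

Lemma is_Cderive_opp_id (z : C) : is_Cderive (fun w => - w) z (- (1)).
Proof.
apply is_Cderive_quadratic with (M := 0%R) (delta := 1%R); [lra|].
intros w _. replace (- w - - z - (w - z) * - (1)) with (RtoC 0) by ring. rewrite Cmod_0. lra.
Qed.

Lemma is_derive_R_eps (f : R -> R) (x l : R) :
  is_derive f x l <->
  (forall eps : R, (0 < eps)%R -> exists delta : R, (0 < delta)%R /\
     forall y : R, (Rabs (y - x) < delta)%R ->
       (Rabs (f y - f x - (y - x) * l) <= eps * Rabs (y - x))%R).
Proof.
split.
- intros [_ H] eps Heps.
  destruct (H x (fun P HP => HP) (mkposreal eps Heps)) as [del Hdel].
  exists del; split; [apply cond_pos|].
  intros w Hw. exact (Hdel w Hw).
- intros H; split.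
  + apply (@is_linear_scal_l R_AbsRing R_NormedModule).
  + intros y Hy.
    assert (E : x = y) by exact (@is_filter_lim_locally_unique R_AbsRing R_NormedModule x y Hy).
    rewrite <- E. intros eps.
    destruct (H eps (cond_pos eps)) as [del [Hdel K]].
    exists (mkposreal del Hdel). intros w Hw. exact (K w Hw).
Qed.

Lemma Cmod_le_sum (z : C) : (Cmod z <= Rabs (Re z) + Rabs (Im z))%R.
Proof.
destruct z as [x y]; unfold Cmod, Re, Im; simpl fst; simpl snd.
pose proof (Rabs_pos x); pose proof (Rabs_pos y).
rewrite <- (sqrt_pow2 (Rabs x + Rabs y)) by lra.
apply sqrt_le_1_alt. rewrite <- (pow2_abs x), <- (pow2_abs y). nra.
Qed.

(** The chain rule for a curve is where complex differentiability meets real calculus: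
    mean value arguments on segments and integrals over circles both go through it.
    The real part suffices, since multiplication of G by -i exchanges the parts. *)
Lemma derive_along_curve (G : C -> C) (gx gy : R -> R) (t gx' gy' : R) (d : C) :
  is_derive gx t gx' -> is_derive gy t gy' -> is_Cderive G (gx t, gy t) d ->
  is_derive (fun s => Re (G (gx s, gy s))) t (Re (d * (gx', gy'))).
Proof.
rewrite !is_derive_R_eps, is_Cderive_eps. intros Hx Hy HG eps Heps.
set (g := fun s => (gx s, gy s) : C). set (v := (gx', gy') : C).
pose proof (Cmod_ge_0 d) as Hd. pose proof (Cmod_ge_0 v) as Hv.
set (e1 := (eps / (2 * (Cmod v + 2)))%R).
set (e2 := Rmin 1 (eps / (4 * (Cmod d + 1)))).
assert (He1 : (0 < e1)%R) by (apply Rdiv_lt_0_compat; lra).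
assert (He2 : (0 < e2)%R) by (apply Rmin_glb_lt; [lra|apply Rdiv_lt_0_compat; lra]).
assert (He2a : (e2 <= 1)%R) by apply Rmin_l.
assert (He2b : (e2 * (Cmod d + 1) <= eps / 4)%R).
{ apply Rle_trans with (eps / (4 * (Cmod d + 1)) * (Cmod d + 1))%R; [|right; field; lra].
  apply Rmult_le_compat_r; [lra|apply Rmin_r]. }
assert (He1b : (e1 * (Cmod v + 2) = eps / 2)%R) by (unfold e1; field; lra).
destruct (Hx (e2 / 2)%R ltac:(lra)) as [d1 [Hd1 K1]].
destruct (Hy (e2 / 2)%R ltac:(lra)) as [d2 [Hd2 K2]].
destruct (HG e1 He1) as [d3 [Hd3 K3]].
exists (Rmin (Rmin d1 d2) (d3 / (Cmod v + 2))). split.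
{ repeat apply Rmin_glb_lt; try lra. apply Rdiv_lt_0_compat; lra. }
intros s Hs.
pose proof (Rmin_l (Rmin d1 d2) (d3 / (Cmod v + 2))).
pose proof (Rmin_r (Rmin d1 d2) (d3 / (Cmod v + 2))).
pose proof (Rmin_l d1 d2). pose proof (Rmin_r d1 d2).
specialize (K1 s ltac:(lra)). specialize (K2 s ltac:(lra)).
assert (E : (Cmod (g s - g t - RtoC (s - t) * v) <= e2 * Rabs (s - t))%R).
{ apply Rle_trans with (1 := Cmod_le_sum _). unfold g, v, Re, Im; simpl.
  replace (gx s + - gx t + - ((s - t) * gx' - 0 * gy'))%R with (gx s - gx t - (s - t) * gx')%R by ring.
  replace (gy s + - gy t + - ((s - t) * gy' + 0 * gx'))%R with (gy s - gy t - (s - t) * gy')%R by ring.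
  lra. }
assert (Eg : (Cmod (g s - g t) <= (Cmod v + 1) * Rabs (s - t))%R).
{ replace (g s - g t) with ((g s - g t - RtoC (s - t) * v) + RtoC (s - t) * v) by ring.
  apply Rle_trans with (1 := Cmod_triangle _ _). rewrite Cmod_mult, Cmod_R.
  pose proof (Rabs_pos (s - t)). nra. }
assert (Hs3 : (Rabs (s - t) * (Cmod v + 2) < d3)%R).
{ apply Rlt_le_trans with (d3 / (Cmod v + 2) * (Cmod v + 2))%R; [|right; field; lra].
  apply Rmult_lt_compat_r; lra. }
pose proof (Rabs_pos (s - t)) as Hst.
specialize (K3 (g s)).
assert (K3' : (Cmod (G (g s) - G (g t) - (g s - g t) * d) <= e1 * Cmod (g s - g t))%R).
{ apply K3. change (Cmod (g s - g t) < d3)%R. nra. }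
replace (Re (G (gx s, gy s)) - Re (G (gx t, gy t)) - (s - t) * Re (d * v))%R
  with (Re ((G (g s) - G (g t) - (g s - g t) * d) + (g s - g t - RtoC (s - t) * v) * d)).
2: { unfold g. destruct (G (gx s, gy s)), (G (gx t, gy t)), d; unfold v, Re; simpl; ring. }
apply Rle_trans with (1 := re_le_Cmod _).
apply Rle_trans with (1 := Cmod_triangle _ _). rewrite Cmod_mult.
assert (A1 : (e1 * Cmod (g s - g t) <= eps / 2 * Rabs (s - t))%R).
{ rewrite <- He1b, Rmult_assoc. apply Rmult_le_compat_l; nra. }
assert (A2 : (Cmod (g s - g t - RtoC (s - t) * v) * Cmod d <= eps / 4 * Rabs (s - t))%R).
{ apply Rle_trans with (e2 * Rabs (s - t) * Cmod d)%R.
  - apply Rmult_le_compat_r; lra.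
  - assert (e2 * Cmod d <= eps/4)%R by nra. nra. }
nra.
Qed.

Lemma derive_along_curve_Im (G : C -> C) (gx gy : R -> R) (t gx' gy' : R) (d : C) :
  is_derive gx t gx' -> is_derive gy t gy' -> is_Cderive G (gx t, gy t) d ->
  is_derive (fun s => Im (G (gx s, gy s))) t (Im (d * (gx', gy'))).
Proof.
intros Hx Hy HG.
apply is_derive_ext with (fun s => Re ((- Ci) * G (gx s, gy s))).
{ intros s. destruct (G (gx s, gy s)); unfold Re, Im; simpl; ring. }
replace (Im (d * (gx', gy'))) with (Re (((- Ci) * d) * (gx', gy'))).
2: { destruct d; unfold Re, Im; simpl; ring. }
apply (derive_along_curve (fun w => (- Ci) * G w) gx gy t gx' gy'); auto.
apply is_Cderive_congr with (0 * G (gx t, gy t) + (- Ci) * d); [ring|].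
apply (is_Cderive_mult (fun _ => - Ci) G); [apply is_Cderive_const|exact HG].
Qed.

(** * Complex series *)

Definition is_Cseries (a : nat -> C) (l : C) : Prop := @is_series C_AbsRing C_NormedModule a l.

Lemma Re_sum_n (a : nat -> C) (n : nat) :
  Re (@sum_n C_AbsRing a n) = sum_n (fun k => Re (a k)) n.
Proof.
induction n as [|n IH]; [now rewrite !sum_O|].
rewrite !sum_Sn, <- IH. reflexivity.
Qed.

Lemma Im_sum_n (a : nat -> C) (n : nat) :
  Im (@sum_n C_AbsRing a n) = sum_n (fun k => Im (a k)) n.
Proof.
induction n as [|n IH]; [now rewrite !sum_O|].
rewrite !sum_Sn, <- IH. reflexivity.
Qed.

Lemma is_Cseries_iff (a : nat -> C) (l : C) :
  is_Cseries a l <->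
  is_series (fun n => Re (a n)) (Re l) /\ is_series (fun n => Im (a n)) (Im l).
Proof.
unfold is_Cseries, is_series. split.
- intros H. split.
  + apply filterlim_locally. intros eps.
    pose proof (proj1 (filterlim_locally _ _) H eps) as [N K].
    exists N. intros n Hn. specialize (K n Hn).
    rewrite <- Re_sum_n. apply (proj1 K).
  + apply filterlim_locally. intros eps.
    pose proof (proj1 (filterlim_locally _ _) H eps) as [N K].
    exists N. intros n Hn. specialize (K n Hn).
    rewrite <- Im_sum_n. apply (proj2 K).
- intros [H1 H2]. apply filterlim_locally. intros eps.
  destruct (proj1 (filterlim_locally _ _) H1 eps) as [N1 K1].
  destruct (proj1 (filterlim_locally _ _) H2 eps) as [N2 K2].
  exists (max N1 N2). intros n Hn.
  specialize (K1 n ltac:(lia)). specialize (K2 n ltac:(lia)).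
  rewrite <- Re_sum_n in K1. rewrite <- Im_sum_n in K2. split; assumption.
Qed.

Lemma is_Cseries_plus (a b : nat -> C) (l m : C) :
  is_Cseries a l -> is_Cseries b m -> is_Cseries (fun n => a n + b n) (l + m).
Proof. apply (@is_series_plus C_AbsRing C_NormedModule). Qed.

Lemma is_Cseries_scal (c : C) (a : nat -> C) (l : C) :
  is_Cseries a l -> is_Cseries (fun n => c * a n) (c * l).
Proof. apply (@is_series_scal C_AbsRing C_NormedModule). Qed.

Lemma is_Cseries_ext (a b : nat -> C) (l : C) : (forall n, a n = b n) -> is_Cseries a l -> is_Cseries b l.
Proof. apply (@is_series_ext C_AbsRing C_NormedModule). Qed.

Lemma is_Cseries_shift (a : nat -> C) (l : C) :
  is_Cseries (fun n => a (S n)) l -> is_Cseries a (a O + l).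
Proof.
intros H. apply (@is_series_decr_1 C_AbsRing C_NormedModule).
replace (plus (a O + l : C_NormedModule) (opp (a O : C_NormedModule))) with (l : C_NormedModule).
- exact H.
- change (l = a O + l + - a O). ring.
Qed.

(** Norm bounds for sums of majorised series; every quantitative estimate on a power
    series below is obtained through it. *)
Lemma is_Cseries_norm_le (a : nat -> C) (v : nat -> R) (l : C) (K : R) :
  is_Cseries a l -> is_series v K -> (forall n, (Cmod (a n) <= v n)%R) -> (Cmod l <= K)%R.
Proof.
intros Ha Hv H.
assert (S : forall n, (Cmod (@sum_n C_AbsRing a n) <= sum_n v n)%R).
{ induction n as [|n IH]; [rewrite !sum_O; apply H|].
  rewrite !sum_Sn. apply Rle_trans with (1 := Cmod_triangle _ _).
  apply Rplus_le_compat; [apply IH|apply H]. }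
apply Rnot_lt_le. intros Hlt.
set (e := ((Cmod l - K) / 4)%R).
assert (He : (0 < e)%R) by (unfold e; lra).
pose proof (proj1 (filterlim_locally _ _) Ha (mkposreal e He)) as [N1 K1].
pose proof (proj1 (filterlim_locally _ _) Hv (mkposreal e He)) as [N2 K2].
specialize (K1 (max N1 N2) ltac:(lia)). specialize (K2 (max N1 N2) ltac:(lia)).
specialize (S (max N1 N2)).
pose proof (C_NormedModule_mixin_compat2 _ _ _ K1) as M1.
change (Cmod (@sum_n C_AbsRing a (max N1 N2) - l) < sqrt 2 * e)%R in M1.
change (Rabs (sum_n v (max N1 N2) - K) < e)%R in K2.
apply Rabs_def2 in K2.
pose proof (Cmod_triangle_inv l (@sum_n C_AbsRing a (max N1 N2))) as T.
replace (l - @sum_n C_AbsRing a (max N1 N2)) with (- (@sum_n C_AbsRing a (max N1 N2) - l)) in T by ring.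
rewrite Cmod_opp in T.
assert (sqrt 2 < 2)%R.
{ rewrite <- (sqrt_pow2 2) at 2 by lra. apply sqrt_lt_1; lra. }
assert (sqrt 2 * e <= 2 * e)%R by nra.
unfold e in *. lra.
Qed.

(** Absolute convergence on all smaller closed disks is the form in which a radius of
    convergence at least rho is passed around: it is stable under termwise
    differentiation and index shift. *)
Definition abs_conv (a : nat -> C) (rho : R) : Prop :=
  forall s, (0 <= s < rho)%R -> ex_series (fun n => Cmod (a n) * s ^ n)%R.

Definition CPSeries (a : nat -> C) (z : C) : C :=
  (Series (fun n => Re (a n * z ^ n)), Series (fun n => Im (a n * z ^ n))).

Definition coef_derive (a : nat -> C) (n : nat) : C := RtoC (INR (S n)) * a (S n).

Lemma CPSeries_correct_abs (a : nat -> C) (z : C) :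
  ex_series (fun n => Cmod (a n) * Cmod z ^ n)%R -> is_Cseries (fun n => a n * z ^ n) (CPSeries a z).
Proof.
intros H. apply is_Cseries_iff. split; apply Series_correct.
- apply (@ex_series_le R_AbsRing R_CompleteNormedModule) with (2 := H).
  intros n. rewrite <- Cmod_pow, <- Cmod_mult. apply re_le_Cmod.
- apply (@ex_series_le R_AbsRing R_CompleteNormedModule) with (2 := H).
  intros n. rewrite <- Cmod_pow, <- Cmod_mult.
  apply Rle_trans with (2 := Rmax_Cmod _). apply Rmax_r.
Qed.

Lemma CPSeries_correct (a : nat -> C) (rho : R) (z : C) :
  abs_conv a rho -> (Cmod z < rho)%R -> is_Cseries (fun n => a n * z ^ n) (CPSeries a z).
Proof.
intros H Hz. apply CPSeries_correct_abs, H. split; [apply Cmod_ge_0|exact Hz].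
Qed.

Lemma CPSeries_eq (a : nat -> C) (z l : C) : is_Cseries (fun n => a n * z ^ n) l -> CPSeries a z = l.
Proof.
intros H. apply is_Cseries_iff in H. destruct H as [H1 H2].
apply injective_projections; now apply is_series_unique.
Qed.

(** This reduces questions on radii to real power series, where the radius of the
    derived series is known. *)
Lemma abs_conv_radius (a : nat -> C) (rho : R) :
  abs_conv a rho <-> Rbar_le rho (CV_radius (fun n => Cmod (a n))).
Proof.
split.
- intros H.
  destruct (Rbar_le_lt_dec rho (CV_radius (fun n => Cmod (a n)))) as [|Hlt]; [assumption|].
  exfalso.
  pose proof (CV_radius_ge_0 (fun n => Cmod (a n))) as H0.
  pose proof (CV_disk_outside (fun n => Cmod (a n))) as HO.
  destruct (CV_radius (fun n => Cmod (a n))) as [r| |] eqn:E; simpl in *; try contradiction.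
  set (s := ((r + rho) / 2)%R).
  assert (Hs : (0 <= s < rho)%R) by (unfold s; lra).
  apply (HO s); [rewrite Rabs_pos_eq; unfold s; lra|].
  apply ex_series_lim_0. apply H, Hs.
- intros H s Hs.
  pose proof (CV_disk_inside (fun n => Cmod (a n)) s) as K.
  apply ex_series_ext with (a := fun n => Rabs (Cmod (a n) * s ^ n)).
  + intros n. apply Rabs_pos_eq, Rmult_le_pos; [apply Cmod_ge_0|now apply pow_le].
  + apply K. apply Rbar_lt_le_trans with (2 := H). rewrite Rabs_pos_eq; simpl; lra.
Qed.

Lemma abs_conv_derive (a : nat -> C) (rho : R) :
  abs_conv a rho -> abs_conv (coef_derive a) rho.
Proof.
rewrite !abs_conv_radius. intros H.
rewrite <- CV_radius_derive in H.
rewrite (CV_radius_ext _ (PS_derive (fun n => Cmod (a n)))); [exact H|].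
intros n. unfold coef_derive, PS_derive. rewrite Cmod_mult, Cmod_R, Rabs_pos_eq; [reflexivity|].
apply pos_INR.
Qed.

(** Terms of a convergent series tend to 0, which bounds the radius of convergence of
    the real series of the moduli from below (Abel's lemma). *)
Lemma abs_conv_of_is_Cseries (f : C -> C) (a : nat -> C) (rho : R) :
  (forall z, (Cmod z < rho)%R -> is_Cseries (fun n => a n * z ^ n) (f z)) -> abs_conv a rho.
Proof.
intros H. apply abs_conv_radius.
destruct (Rbar_le_lt_dec rho (CV_radius (fun n => Cmod (a n)))) as [|Hlt]; [assumption|].
exfalso.
pose proof (CV_radius_ge_0 (fun n => Cmod (a n))) as H0.
pose proof (CV_disk_outside (fun n => Cmod (a n))) as HO.
destruct (CV_radius (fun n => Cmod (a n))) as [r| |] eqn:E; simpl in *; try contradiction.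
set (s := ((r + rho) / 2)%R).
assert (Hs : (0 <= s < rho)%R) by (unfold s; lra).
apply (HO s); [rewrite Rabs_pos_eq; unfold s; lra|].
assert (Hs' : (Cmod (RtoC s) < rho)%R) by (rewrite Cmod_R, Rabs_pos_eq; lra).
specialize (H (RtoC s) Hs'). apply is_Cseries_iff in H. destruct H as [H1 H2].
pose proof (ex_series_lim_0 _ (ex_intro _ _ H1)) as L1.
pose proof (ex_series_lim_0 _ (ex_intro _ _ H2)) as L2.
apply is_lim_seq_abs_0 in L1. apply is_lim_seq_abs_0 in L2.
apply (is_lim_seq_le_le (fun _ => 0%R) _ (fun n => Rabs (Re (a n * RtoC s ^ n)) + Rabs (Im
  (a n * RtoC s ^ n)))%R).
- intros n. replace (Cmod (a n) * s ^ n)%R with (Cmod (a n * RtoC s ^ n)).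
  + split; [apply Cmod_ge_0|apply Cmod_le_sum].
  + rewrite Cmod_mult, Cmod_pow, Cmod_R, Rabs_pos_eq; lra.
- apply is_lim_seq_const.
- replace (Finite 0) with (Finite (0 + 0)) by (f_equal; ring).
  apply is_lim_seq_plus'; assumption.
Qed.

(** * Power series and cubic jets *)

Lemma is_Cseries_tail (a : nat -> C) (l : C) : is_Cseries a l -> is_Cseries (fun n => a (S n)) (l - a O).
Proof.
intros H. apply (@is_series_incr_1 C_AbsRing C_NormedModule).
replace (plus (l - a O : C_NormedModule) (a O : C_NormedModule)) with (l : C_NormedModule).
- exact H.
- change (l = l - a O + a O). ring.
Qed.

(** The error of the linearisation of a power is quadratic in the increment, with a
    constant that is the coefficient of the twice derived series. Induction works
    because w times the error in degree n differs from the error in degree n+1 by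
    exactly n z^(n-1) (w - z)^2. *)
Lemma Cpow_taylor_bound (z w : C) (s : R) (n : nat) :
  (Cmod z <= s)%R -> (Cmod w <= s)%R ->
  (Cmod (w ^ S (S n) - z ^ S (S n) - (w - z) * (RtoC (INR (S (S n))) * z ^ S n))
   <= INR (S n) * INR (S (S n)) * s ^ n * Cmod (w - z) ^ 2)%R.
Proof.
intros Hz Hw.
assert (Hs : (0 <= s)%R) by (pose proof (Cmod_ge_0 z); lra).
induction n as [|n IH].
- replace (w ^ 2 - z ^ 2 - (w - z) * (RtoC (INR 2) * z ^ 1)) with ((w - z) * (w - z)).
  + rewrite Cmod_mult. simpl. pose proof (Cmod_ge_0 (w - z)). nra.
  + simpl INR. rewrite RtoC_plus. ring.
- replace (w ^ S (S (S n)) - z ^ S (S (S n)) - (w - z) * (RtoC (INR (S (S (S n)))) * z ^ S (S n)))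
    with (w * (w ^ S (S n) - z ^ S (S n) - (w - z) * (RtoC (INR (S (S n))) * z ^ S n))
          + RtoC (INR (S (S n))) * z ^ S n * ((w - z) * (w - z))).
  2: { rewrite (S_INR (S (S n))), RtoC_plus, !Cpow_S. ring. }
  apply Rle_trans with (1 := Cmod_triangle _ _).
  rewrite !Cmod_mult, Cmod_R, Rabs_pos_eq, Cmod_pow by apply pos_INR.
  set (e := Cmod (w ^ S (S n) - z ^ S (S n) - (w - z) * (RtoC (INR (S (S n))) * z ^ S n))) in *.
  pose proof (Cmod_ge_0 (w - z)) as Hd. set (d := Cmod (w - z)) in *.
  assert (A : (Cmod w * e <= s * (INR (S n) * INR (S (S n)) * s ^ n * d ^ 2))%R).
  { apply Rmult_le_compat; auto; apply Cmod_ge_0. }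
  assert (B : (Cmod z ^ S n <= s ^ S n)%R).
  { apply pow_incr. split; [apply Cmod_ge_0|exact Hz]. }
  pose proof (pos_INR n). pose proof (pow_le s n Hs).
  rewrite !S_INR in *. simpl pow in *.
  assert (B' : ((INR n + 1 + 1) * (Cmod z * Cmod z ^ n) * (d * d) <= (INR n + 1 + 1) *
    (s * s ^ n) * (d * d))%R).
  { apply Rmult_le_compat_r; [nra|]. apply Rmult_le_compat_l; lra. }
  assert (0 <= s * s ^ n * (d * d))%R by (apply Rmult_le_pos; nra).
  set (X := (s * s ^ n * (d * d))%R) in *.
  replace ((INR n + 1 + 1) * (s * s ^ n) * (d * d))%R with ((INR n + 1 + 1) * X)%R in B' by (unfold X; ring).
  replace (s * ((INR n + 1) * (INR n + 1 + 1) * s ^ n * (d * (d * 1))))%R with ((INR n + 1) *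
    (INR n + 1 + 1) * X)%R in A by (unfold X; ring).
  replace ((INR n + 1 + 1) * (INR n + 1 + 1 + 1) * (s * s ^ n) * (d * (d * 1)))%R with
    ((INR n + 1 + 1) * (INR n + 1 + 1 + 1) * X)%R by (unfold X; ring).
  nra.
Qed.

(** Summing [Cpow_taylor_bound] over the series bounds the error of the linearisation
    by a constant times |w - z|^2, the constant being the sum of the twice derived
    series of moduli. *)
Lemma CPSeries_derive (a : nat -> C) (rho : R) (z : C) :
  abs_conv a rho -> (Cmod z < rho)%R -> is_Cderive (CPSeries a) z (CPSeries (coef_derive a) z).
Proof.
intros Ha Hz.
pose proof (Cmod_ge_0 z) as Hz0.
set (s := ((Cmod z + rho) / 2)%R).
pose proof (abs_conv_derive _ _ (abs_conv_derive _ _ Ha) s ltac:(unfold s; lra)) as [K HK].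
apply is_Cderive_quadratic with (M := K) (delta := (s - Cmod z)%R); [unfold s; lra|].
intros w Hw.
assert (Hws : (Cmod w <= s)%R).
{ pose proof (Cmod_triangle_inv w z). lra. }
pose proof (CPSeries_correct a rho w Ha ltac:(unfold s in *; lra)) as S1.
pose proof (CPSeries_correct a rho z Ha Hz) as S2.
pose proof (CPSeries_correct _ rho z (abs_conv_derive _ _ Ha) Hz) as S3.
set (u := fun n => a n * w ^ n + - (1) * (a n * z ^ n)
   + - (w - z) * (match n with O => RtoC 0 | S m => coef_derive a m * z ^ m end)).
assert (Su : is_Cseries u (CPSeries a w - CPSeries a z - (w - z) * CPSeries (coef_derive a) z)).
{ replace (CPSeries a w - CPSeries a z - (w - z) * CPSeries (coef_derive a) z)
    with (CPSeries a w + - (1) * CPSeries a z + - (w - z) * (0 + CPSeries (coef_derive a) z)) by ring.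
  apply is_Cseries_plus; [apply is_Cseries_plus; [exact S1|]|].
  - now apply is_Cseries_scal.
  - apply is_Cseries_scal.
    apply (is_Cseries_shift (fun n => match n with O => RtoC 0 | S m => coef_derive a m * z ^ m end)).
    exact S3. }
pose proof (is_Cseries_tail _ _ (is_Cseries_tail _ _ Su)) as St. cbv beta in St.
replace (u 1%nat) with (RtoC 0) in St.
2: { unfold u, coef_derive. simpl INR. simpl Cpow. ring. }
replace (u 0%nat) with (RtoC 0) in St by (unfold u; simpl Cpow; ring).
replace (CPSeries a w - CPSeries a z - (w - z) * CPSeries (coef_derive a) z - 0 - 0)
  with (CPSeries a w - CPSeries a z - (w - z) * CPSeries (coef_derive a) z) in St by ring.
apply is_Cseries_norm_le with (1 := St)
  (v := fun n => (Cmod (w - z) ^ 2 * (Cmod (coef_derive (coef_derive a) n) * s ^ n))%R).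
- rewrite Rmult_comm. apply (@is_series_scal R_AbsRing R_NormedModule). exact HK.
- intros n. unfold u, coef_derive.
  replace (a (S (S n)) * w ^ S (S n) + - (1) * (a (S (S n)) * z ^ S (S n)) +
     - (w - z) * (RtoC (INR (S (S n))) * a (S (S n)) * z ^ S n))
   with (a (S (S n)) * (w ^ S (S n) - z ^ S (S n) - (w - z) * (RtoC (INR (S (S n))) * z ^ S n))) by ring.
  rewrite !Cmod_mult, !Cmod_R, !Rabs_pos_eq by apply pos_INR.
  apply Rle_trans with (Cmod (a (S (S n))) * (INR (S n) * INR (S (S n)) * s ^ n * Cmod (w - z) ^ 2))%R.
  + apply Rmult_le_compat_l; [apply Cmod_ge_0|].
    apply Cpow_taylor_bound; unfold s in *; lra.
  + right; ring.
Qed.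

Lemma abs_conv_shift (a : nat -> C) (rho : R) :
  abs_conv a rho -> abs_conv (fun n => a (S n)) rho.
Proof.
intros H s Hs. destruct (Req_dec s 0) as [->|Hs0].
- apply ex_series_ext with (fun n => (Cmod (a 1%nat) * 0 ^ n + (0 * 0 ^ n))%R).
  + intros [|n]; simpl; ring.
  + assert (E : ex_series (fun n => 0 ^ n)%R) by (apply ex_series_geom; rewrite Rabs_R0; lra).
    apply (@ex_series_plus R_AbsRing R_NormedModule);
      apply (@ex_series_scal R_AbsRing R_NormedModule); exact E.
- apply ex_series_ext with (fun n => / s * (Cmod (a (S n)) * s ^ S n))%R.
  + intros n. simpl. field. exact Hs0.
  + apply (@ex_series_scal R_AbsRing R_NormedModule).
    apply (ex_series_incr_1 (fun n => Cmod (a n) * s ^ n)%R). apply H, Hs.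
Qed.

Lemma CPSeries_step (a : nat -> C) (rho : R) (z : C) :
  abs_conv a rho -> (Cmod z < rho)%R ->
  CPSeries a z = a O + z * CPSeries (fun n => a (S n)) z.
Proof.
intros H Hz. apply CPSeries_eq.
replace (a O) with (a O * z ^ 0) at 1 by (simpl; ring).
apply (is_Cseries_shift (fun n => a n * z ^ n)).
apply is_Cseries_ext with (fun n => z * (a (S n) * z ^ n)).
- intros n. rewrite Cpow_S. ring.
- apply is_Cseries_scal, (CPSeries_correct _ rho); [now apply abs_conv_shift|exact Hz].
Qed.

Lemma CPSeries_0 (a : nat -> C) (rho : R) : abs_conv a rho -> (0 < rho)%R -> CPSeries a 0 = a O.
Proof.
intros H Hr. rewrite (CPSeries_step a rho 0 H); [ring|]. rewrite Cmod_0; exact Hr.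
Qed.

(** Taylor polynomials of degree 3 with an O(z^4) remainder. They replace power series
    for functions, such as a Schwarz function, which are not known to be sums of power
    series. *)
Definition jet (f : C -> C) (p0 p1 p2 p3 : C) : Prop :=
  exists M delta : R, (0 < delta)%R /\ forall z : C, (Cmod z < delta)%R ->
    (Cmod (f z - (p0 + p1 * z + p2 * z ^ 2 + p3 * z ^ 3)) <= M * Cmod z ^ 4)%R.

Lemma is_Cderive_locally_bounded (g : C -> C) (z d : C) : is_Cderive g z d ->
  exists delta, (0 < delta)%R /\ forall w, (Cmod (w - z) < delta)%R -> (Cmod (g w) <= Cmod (g z) + 1)%R.
Proof.
intros H. destruct (is_Cderive_continuous g z d H 1%R Rlt_0_1) as [del [Hd K]].
exists del; split; [exact Hd|]. intros w Hw. specialize (K w Hw).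
pose proof (Cmod_triangle_inv (g w) (g z)). lra.
Qed.

Lemma jet_of_factor (f g : C -> C) (p0 p1 p2 p3 : C) (delta M : R) :
  (0 < delta)%R ->
  (forall z, (Cmod z < delta)%R -> f z = p0 + p1 * z + p2 * z ^ 2 + p3 * z ^ 3 + z ^ 4 * g z) ->
  (forall z, (Cmod z < delta)%R -> (Cmod (g z) <= M)%R) ->
  jet f p0 p1 p2 p3.
Proof.
intros Hd Hf Hg. exists M, delta. split; [exact Hd|]. intros z Hz.
rewrite (Hf z Hz).
replace (p0 + p1 * z + p2 * z ^ 2 + p3 * z ^ 3 + z ^ 4 * g z - (p0 + p1 * z + p2 * z ^ 2 + p3 * z ^ 3))
  with (z ^ 4 * g z) by ring.
rewrite Cmod_mult, Cmod_pow, Rmult_comm. apply Rmult_le_compat_r; auto.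
apply pow_le, Cmod_ge_0.
Qed.

Lemma jet_poly (p0 p1 p2 p3 : C) : jet (fun z => p0 + p1 * z + p2 * z ^ 2 + p3 * z ^ 3) p0 p1 p2 p3.
Proof.
apply (jet_of_factor _ (fun _ => RtoC 0) _ _ _ _ 1 0); [lra| |].
- intros; ring.
- intros; rewrite Cmod_0; lra.
Qed.

Lemma jet_CPSeries (a : nat -> C) (rho : R) : abs_conv a rho -> (0 < rho)%R ->
  jet (CPSeries a) (a 0%nat) (a 1%nat) (a 2%nat) (a 3%nat).
Proof.
intros H Hr.
pose proof (abs_conv_shift _ _ H) as H1. pose proof (abs_conv_shift _ _ H1) as H2.
pose proof (abs_conv_shift _ _ H2) as H3. pose proof (abs_conv_shift _ _ H3) as H4.
cbv beta in *.
assert (Z : (Cmod 0 < rho)%R) by (rewrite Cmod_0; exact Hr).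
destruct (is_Cderive_locally_bounded _ _ _ (CPSeries_derive _ _ 0 H4 Z)) as [del [Hdel K]].
apply (jet_of_factor _ (CPSeries (fun n => a (S (S (S (S n)))))) _ _ _ _ (Rmin del rho)
  (Cmod (CPSeries (fun n => a (S (S (S (S n))))) 0) + 1)).
- now apply Rmin_glb_lt.
- intros z Hz. pose proof (Rmin_r del rho).
  assert (Hz' : (Cmod z < rho)%R) by lra.
  rewrite (CPSeries_step _ _ z H Hz'), (CPSeries_step _ _ z H1 Hz'),
    (CPSeries_step _ _ z H2 Hz'), (CPSeries_step _ _ z H3 Hz').
  ring.
- intros z Hz. pose proof (Rmin_l del rho). apply K. replace (z - 0) with z by ring. lra.
Qed.

Lemma jet_ext (f g : C -> C) (p0 p1 p2 p3 : C) (delta : R) : (0 < delta)%R ->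
  (forall z, (Cmod z < delta)%R -> f z = g z) -> jet f p0 p1 p2 p3 -> jet g p0 p1 p2 p3.
Proof.
intros Hd E [M [d [Hd' H]]]. exists M, (Rmin delta d). split; [now apply Rmin_glb_lt|].
intros z Hz. pose proof (Rmin_l delta d). pose proof (Rmin_r delta d).
rewrite <- E by lra. apply H; lra.
Qed.

Lemma jet_plus (f g : C -> C) (p0 p1 p2 p3 q0 q1 q2 q3 : C) :
  jet f p0 p1 p2 p3 -> jet g q0 q1 q2 q3 ->
  jet (fun z => f z + g z) (p0 + q0) (p1 + q1) (p2 + q2) (p3 + q3).
Proof.
intros [M [d [Hd H]]] [N [e [He K]]]. exists (M + N)%R, (Rmin d e).
split; [now apply Rmin_glb_lt|].
intros z Hz. pose proof (Rmin_l d e). pose proof (Rmin_r d e).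
specialize (H z ltac:(lra)). specialize (K z ltac:(lra)).
match goal with |- (Cmod ?x <= _)%R => replace x with
 ((f z - (p0 + p1 * z + p2 * z ^ 2 + p3 * z ^ 3)) + (g z -
   (q0 + q1 * z + q2 * z ^ 2 + q3 * z ^ 3))) by ring end.
apply Rle_trans with (1 := Cmod_triangle _ _). lra.
Qed.

Lemma poly_bound (p0 p1 p2 p3 z : C) : (Cmod z < 1)%R ->
  (Cmod (p0 + p1 * z + p2 * z ^ 2 + p3 * z ^ 3) <= Cmod p0 + Cmod p1 + Cmod p2 + Cmod p3)%R.
Proof.
intros Hz. pose proof (Cmod_ge_0 z).
assert (A : (forall p n, Cmod (p * z ^ n) <= Cmod p)%R).
{ intros p n. rewrite Cmod_mult, Cmod_pow. rewrite <- (Rmult_1_r (Cmod p)) at 2.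
  apply Rmult_le_compat_l; [apply Cmod_ge_0|]. rewrite <- (pow1 n). apply pow_incr; lra. }
pose proof (A p1 1%nat) as A1. rewrite Cpow_1_r in A1.
pose proof (A p2 2%nat). pose proof (A p3 3%nat).
repeat (apply Rle_trans with (1 := Cmod_triangle _ _); apply Rplus_le_compat; auto).
lra.
Qed.

Lemma jet_mult (f g : C -> C) (p0 p1 p2 p3 q0 q1 q2 q3 : C) :
  jet f p0 p1 p2 p3 -> jet g q0 q1 q2 q3 ->
  jet (fun z => f z * g z) (p0 * q0) (p0 * q1 + p1 * q0) (p0 * q2 + p1 * q1 + p2 * q0)
      (p0 * q3 + p1 * q2 + p2 * q1 + p3 * q0).
Proof.
intros [M [d [Hd H]]] [N [e [He K]]].
set (BP := (Cmod p0 + Cmod p1 + Cmod p2 + Cmod p3)%R).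
set (BQ := (Cmod q0 + Cmod q1 + Cmod q2 + Cmod q3)%R).
set (BR := (Cmod (p1 * q3 + p2 * q2 + p3 * q1) + Cmod (p2 * q3 + p3 * q2) + Cmod (p3 * q3) + Cmod 0)%R).
exists (Rabs M * (Rabs N + BQ) + BP * Rabs N + BR)%R, (Rmin 1 (Rmin d e)).
split; [repeat apply Rmin_glb_lt; auto; lra|].
intros z Hz. pose proof (Rmin_l 1 (Rmin d e)). pose proof (Rmin_r 1 (Rmin d e)).
pose proof (Rmin_l d e). pose proof (Rmin_r d e).
specialize (H z ltac:(lra)). specialize (K z ltac:(lra)).
assert (Hz1 : (Cmod z < 1)%R) by lra.
pose proof (poly_bound p0 p1 p2 p3 z Hz1) as HP. fold BP in HP.
pose proof (poly_bound q0 q1 q2 q3 z Hz1) as HQ. fold BQ in HQ.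
pose proof (poly_bound (p1 * q3 + p2 * q2 + p3 * q1) (p2 * q3 + p3 * q2)
  (p3 * q3) 0 z Hz1) as HR. fold BR in HR.
set (P := p0 + p1 * z + p2 * z ^ 2 + p3 * z ^ 3) in *.
set (Q := q0 + q1 * z + q2 * z ^ 2 + q3 * z ^ 3) in *.
set (U := (p1 * q3 + p2 * q2 + p3 * q1) + (p2 * q3 + p3 * q2) * z + (p3 * q3) * z ^ 2 + 0 * z ^ 3) in *.
match goal with |- (Cmod ?x <= _)%R => replace x with
 ((f z - P) * ((g z - Q) + Q) + P * (g z - Q) + z ^ 4 * U) by (unfold P, Q, U; ring) end.
pose proof (Cmod_ge_0 z).
assert (T0 : (0 <= Cmod z ^ 4 <= 1)%R).
{ split; [now apply pow_le|]. rewrite <- (pow1 4). apply pow_incr; lra. }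
set (t := (Cmod z ^ 4)%R) in *.
assert (HM : (Cmod (f z - P) <= Rabs M * t)%R).
{ apply Rle_trans with (1 := H). apply Rmult_le_compat_r; [lra|apply Rle_abs]. }
assert (HN : (Cmod (g z - Q) <= Rabs N * t)%R).
{ apply Rle_trans with (1 := K). apply Rmult_le_compat_r; [lra|apply Rle_abs]. }
pose proof (Rabs_pos M). pose proof (Rabs_pos N).
assert (HN' : (Cmod (g z - Q) <= Rabs N)%R) by nra.
apply Rle_trans with (1 := Cmod_triangle _ _).
rewrite Cmod_mult with (x := z ^ 4), Cmod_pow. fold t.
apply Rle_trans with (Rabs M * t * (Rabs N + BQ) + BP * (Rabs N * t) + t * BR)%R; [|right; ring].
apply Rplus_le_compat; [apply Rle_trans with (1 := Cmod_triangle _ _)|].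
- rewrite !Cmod_mult. apply Rplus_le_compat.
  + apply Rmult_le_compat; try apply Cmod_ge_0; [exact HM|].
    apply Rle_trans with (1 := Cmod_triangle _ _). lra.
  + apply Rmult_le_compat; try apply Cmod_ge_0; [exact HP|exact HN].
- apply Rmult_le_compat_l; [lra|exact HR].
Qed.

Arguments jet_plus {f g p0 p1 p2 p3 q0 q1 q2 q3} _ _.
Arguments jet_mult {f g p0 p1 p2 p3 q0 q1 q2 q3} _ _.

Lemma jet_congr (f : C -> C) (p0 p1 p2 p3 q0 q1 q2 q3 : C) :
  p0 = q0 -> p1 = q1 -> p2 = q2 -> p3 = q3 -> jet f p0 p1 p2 p3 -> jet f q0 q1 q2 q3.
Proof. intros -> -> -> ->; trivial. Qed.

(** * The exponential *)

Lemma Cexp_plus (z w : C) : Cexp (z + w) = Cexp z * Cexp w.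
Proof.
unfold Cexp, Re, Im, Cmult; simpl. rewrite exp_plus, cos_plus, sin_plus.
apply injective_projections; simpl; ring.
Qed.

Lemma Cexp_0 : Cexp 0 = 1.
Proof.
unfold Cexp, Re, Im; simpl. rewrite exp_0, cos_0, sin_0.
apply injective_projections; simpl; ring.
Qed.

Definition exp_coef (n : nat) : C := RtoC (/ INR (fact n)).

Lemma exp_coef_derive (n : nat) : coef_derive exp_coef n = exp_coef n.
Proof.
unfold coef_derive, exp_coef. rewrite <- RtoC_mult. f_equal.
rewrite fact_simpl, mult_INR. pose proof (INR_fact_neq_0 n).
pose proof (not_0_INR (S n) ltac:(lia)).
field; auto.
Qed.

Lemma exp_coef_abs (rho : R) : abs_conv exp_coef rho.
Proof.
intros s Hs. exists (exp s).
apply is_series_ext with (2 := proj1 (is_pseries_R _ _ _) (is_exp_Reals s)).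
intros n. unfold exp_coef. rewrite Cmod_R, Rabs_pos_eq; [reflexivity|].
left; apply Rinv_0_lt_compat, INR_fact_lt_0.
Qed.

Lemma CPSeries_exp_derive (z : C) : is_Cderive (CPSeries exp_coef) z (CPSeries exp_coef z).
Proof.
pose proof (Cmod_ge_0 z).
apply is_Cderive_congr with (CPSeries (coef_derive exp_coef) z).
- unfold CPSeries. f_equal; apply Series_ext; intros n; now rewrite exp_coef_derive.
- apply (CPSeries_derive _ (Cmod z + 1)); [apply exp_coef_abs|lra].
Qed.

Lemma const_of_zero_derive (u : R -> R) :
  (forall t, is_derive u t 0%R) -> u 1%R = u 0%R.
Proof.
intros H. destruct (MVT_gen u 0 1 (fun _ => 0%R)) as [c [_ E]].
- intros; apply H.
- intros x _. apply continuity_pt_filterlim.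
  apply (ex_derive_continuous (V := R_NormedModule) u). eexists; apply H.
- lra.
Qed.

(** The real part of the product rule for e^(-t (x + i y)) (p + i q). The imaginary
    part is the same formula for q and -p. *)
Lemma is_derive_rotated (p q : R -> R) (x y t p' q' : R) :
  is_derive p t p' -> is_derive q t q' ->
  is_derive (fun t => exp (- (t * x)) * (cos (- (t * y)) * p t - sin (- (t * y)) * q t))%R t
    (exp (- (t * x)) * (cos (- (t * y)) * (p' - x * p t + y * q t)
                        - sin (- (t * y)) * (q' - x * q t - y * p t)))%R.
Proof.
intros Hp Hq. auto_derive.
- repeat split; eexists; eassumption.
- assert (Ep : Derive (fun s => p s) t = p') by now apply is_derive_unique.
  assert (Eq : Derive (fun s => q s) t = q') by now apply is_derive_unique.
  rewrite Ep, Eq. ring.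
Qed.

(** Along the ray through z, the product of e^(-tz) and the exponential series at tz
    has derivative zero, and it is 1 at t = 0. *)
Lemma CPSeries_exp_opp (z : C) : Cexp (- z) * CPSeries exp_coef z = 1.
Proof.
destruct z as [x y].
set (E := CPSeries exp_coef).
assert (D1 : forall t, is_derive (fun t => Re (E (t * x, t * y)))%R t (Re (E (t * x, t * y)%R * (x, y)))).
{ intros t.
  apply (derive_along_curve E (fun t => t * x)%R (fun t => t * y)%R t x y (E (t * x, t * y)%R)).
  - auto_derive; auto; ring.
  - auto_derive; auto; ring.
  - apply CPSeries_exp_derive. }
assert (D2 : forall t, is_derive (fun t => Im (E (t * x, t * y)))%R t (Im (E (t * x, t * y)%R * (x, y)))).
{ intros t.
  apply (derive_along_curve_Im E (fun t => t * x)%R (fun t => t * y)%R t x y (E (t * x, t * y)%R)).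
  - auto_derive; auto; ring.
  - auto_derive; auto; ring.
  - apply CPSeries_exp_derive. }
assert (E0 : E (0, 0)%R = 1).
{ unfold E. change (CPSeries exp_coef 0 = 1). rewrite (CPSeries_0 _ 1); [|apply exp_coef_abs|lra].
  unfold exp_coef; simpl. now rewrite Rinv_1. }
assert (R0 : Re (Cexp (- (x, y)) * E (x, y)) = 1%R).
{ set (u := fun t : R => (exp (- (t * x)) * (cos (- (t * y)) * Re (E (t * x, t * y)) - sin (-
    (t * y)) * Im (E (t * x, t * y))))%R).
  assert (Hu : u 1%R = u 0%R).
  { apply const_of_zero_derive. intros t.
    pose proof (is_derive_rotated _ _ x y t _ _ (D1 t) (D2 t)) as D.
    cbv beta in D. match type of D with is_derive _ _ ?d => assert (Z : d = 0%R) end.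
    { destruct (E (t * x, t * y)%R); unfold Re, Im; simpl; ring. }
    rewrite Z in D. exact D. }
  unfold u in Hu. rewrite !Rmult_1_l, !Rmult_0_l, !Ropp_0, E0, exp_0, cos_0, sin_0 in Hu.
  destruct (E (x, y)); unfold Cexp, Re, Im in *; simpl in *; lra. }
assert (I0 : Im (Cexp (- (x, y)) * E (x, y)) = 0%R).
{ set (u := fun t : R => (exp (- (t * x)) * (cos (- (t * y)) * Im (E (t * x, t * y)) + sin (-
    (t * y)) * Re (E (t * x, t * y))))%R).
  assert (Hu : u 1%R = u 0%R).
  { apply const_of_zero_derive. intros t.
    pose proof (is_derive_rotated _ _ x y t _ _ (D2 t) (is_derive_opp _ _ _ (D1 t))) as D.
    cbv beta in D. match type of D with is_derive _ _ ?d => assert (Z : d = 0%R) end.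
    { destruct (E (t * x, t * y)%R); unfold Re, Im, opp; simpl; ring. }
    rewrite Z in D. apply is_derive_ext with (2 := D).
    intros s. unfold u, opp; simpl; ring. }
  unfold u in Hu. rewrite !Rmult_1_l, !Rmult_0_l, !Ropp_0, E0, exp_0, cos_0, sin_0 in Hu.
  destruct (E (x, y)); unfold Cexp, Re, Im in *; simpl in *; lra. }
apply injective_projections; assumption.
Qed.

Lemma Cexp_Csum (z : C) : Cexp z = CPSeries exp_coef z.
Proof.
rewrite <- (Cmult_1_r (Cexp z)), <- (CPSeries_exp_opp z), Cmult_assoc, <- Cexp_plus.
replace (z + - z) with (RtoC 0) by ring. rewrite Cexp_0. ring.
Qed.

Lemma Cexp_derive (z : C) : is_Cderive Cexp z (Cexp z).
Proof.
rewrite Cexp_Csum.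
apply is_Cderive_ext_loc with (CPSeries exp_coef) 1%R; [lra| |apply CPSeries_exp_derive].
intros; symmetry; apply Cexp_Csum.
Qed.

(** The imaginary part of w stays below pi/2 in absolute value. This gives the
    positivity of 1 + Re z f''/f', from which the absence of zeros of f' follows. *)
Lemma Re_Cexp_pos (w : C) : (Cmod w < 1)%R -> (0 <= Re (Cexp w))%R.
Proof.
intros H. unfold Cexp, Re at 1; simpl.
apply Rmult_le_pos; [left; apply exp_pos|].
assert (A : (Rabs (Im w) < 1)%R).
{ apply Rle_lt_trans with (2 := H). apply Rle_trans with (2 := Rmax_Cmod w). apply Rmax_r. }
apply Rabs_def2 in A. pose proof PI2_1.
apply cos_ge_0; lra.
Qed.

(** The jet of the composition is computed from the cubic Taylor polynomial of the
    exponential, whose error at Q(z) is O(Q(z)^4) = O(z^4). *)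
Lemma jet_Cexp_poly (c1 c2 c3 : C) :
  jet (fun z => Cexp (c1 * z + c2 * z ^ 2 + c3 * z ^ 3)) 1 c1 (c2 + c1 ^ 2 / 2)
   (c3 + c1 * c2 + c1 ^ 3 / 6).
Proof.
set (Q := fun z => 0 + c1 * z + c2 * z ^ 2 + c3 * z ^ 3).
pose proof (jet_poly 0 c1 c2 c3) as J1. fold Q in J1.
pose proof (jet_mult J1 J1) as J2.
pose proof (jet_mult J2 J1) as J3.
pose proof (jet_poly 1 0 0 0) as J0.
pose proof (jet_mult (jet_poly (/ 2) 0 0 0) J2) as K2.
pose proof (jet_mult (jet_poly (/ 6) 0 0 0) J3) as K3.
destruct (jet_CPSeries exp_coef 1 (exp_coef_abs 1) Rlt_0_1) as [M [d [Hd H]]].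
set (B := (Cmod c1 + Cmod c2 + Cmod c3)%R).
assert (HB : (0 <= B)%R).
{ unfold B. pose proof (Cmod_ge_0 c1). pose proof (Cmod_ge_0 c2). pose proof (Cmod_ge_0 c3).
  lra. }
assert (HQ : forall z, (Cmod z < 1)%R -> (Cmod (Q z) <= B * Cmod z)%R).
{ intros z Hz. unfold Q.
  replace (0 + c1 * z + c2 * z ^ 2 + c3 * z ^ 3) with (z * (c1 + c2 * z + c3 * z ^ 2 + 0 * z ^ 3)) by ring.
  rewrite Cmod_mult, Rmult_comm. apply Rmult_le_compat_r; [apply Cmod_ge_0|].
  apply Rle_trans with (1 := poly_bound _ _ _ _ _ Hz). rewrite Cmod_0. unfold B; lra. }
assert (JR : jet (fun z => Cexp (Q z) - (1 + Q z + / 2 * (Q z * Q z) + / 6 * (Q z * Q z * Q z))) 0 0 0 0).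
{ exists (Rabs M * B ^ 4)%R, (Rmin 1 (d / (B + 1))). split.
  - apply Rmin_glb_lt; [lra|]. apply Rdiv_lt_0_compat; lra.
  - intros z Hz. pose proof (Rmin_l 1 (d / (B + 1))). pose proof (Rmin_r 1 (d / (B + 1))).
    specialize (HQ z ltac:(lra)). pose proof (Cmod_ge_0 z).
    assert (Cmod (Q z) < d)%R.
    { apply Rle_lt_trans with (1 := HQ).
      apply Rle_lt_trans with ((B + 1) * Cmod z)%R; [nra|].
      apply Rlt_le_trans with ((B + 1) * (d / (B + 1)))%R; [apply Rmult_lt_compat_l; lra|right; field; lra]. }
    specialize (H (Q z) ltac:(assumption)).
    rewrite <- Cexp_Csum in H. unfold exp_coef in H.
    replace (RtoC (/ INR (fact 0))) with (RtoC 1) in H by (simpl; now rewrite Rinv_1).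
    replace (RtoC (/ INR (fact 1))) with (RtoC 1) in H by (simpl; now rewrite Rinv_1).
    replace (RtoC (/ INR (fact 2))) with (/ RtoC 2) in H by (rewrite <- RtoC_inv by lra; f_equal; simpl; field).
    replace (RtoC (/ INR (fact 3))) with (/ RtoC 6) in H by (rewrite <- RtoC_inv by lra; f_equal; simpl; field).
    match goal with |- (Cmod ?x <= _)%R => replace x with
     (Cexp (Q z) - (1 + 1 * Q z + / 2 * Q z ^ 2 + / 6 * Q z ^ 3)) by ring end.
    apply Rle_trans with (1 := H).
    apply Rle_trans with (Rabs M * Cmod (Q z) ^ 4)%R.
    + apply Rmult_le_compat_r; [apply pow_le, Cmod_ge_0|apply Rle_abs].
    + rewrite Rmult_assoc, <- Rpow_mult_distr. apply Rmult_le_compat_l; [apply Rabs_pos|].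
      apply pow_incr. split; [apply Cmod_ge_0|exact HQ]. }
pose proof (jet_plus (jet_plus (jet_plus (jet_plus JR J0) J1) K2) K3) as J.
refine (jet_congr _ _ _ _ _ _ _ _ _ _ _ _ _ (jet_ext _ _ _ _ _ _ 1 Rlt_0_1 _ J)).
1-4: try field.
all: try (repeat split; intros E; apply RtoC_inj in E; lra).
intros z _. unfold Q.
replace (Cexp (c1 * z + c2 * z ^ 2 + c3 * z ^ 3)) with (Cexp (0 + c1 * z + c2 * z ^ 2 + c3 * z ^ 3)).
2: { f_equal; ring. }
ring.
Qed.

(** * The derivative of a function in the class has no zeros *)

Lemma is_Cseries_of_pseries (a : nat -> C) (z l : C) :
  @is_pseries C_AbsRing C_NormedModule a z l <-> is_Cseries (fun n => a n * z ^ n) l.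
Proof.
split; intros H; [apply is_Cseries_ext with (2 := H)|apply
  (@is_series_ext C_AbsRing C_NormedModule) with (2 := H)];
 intros n; apply Cmult_comm.
Qed.

Lemma Cmod_scale_lt (t : R) (z : C) : (0 <= t <= 1)%R -> (Cmod z < 1)%R -> (Cmod (RtoC t * z) < 1)%R.
Proof.
intros Ht Hz. rewrite Cmod_mult, Cmod_R, Rabs_pos_eq by lra. pose proof (Cmod_ge_0 z). nra.
Qed.

Lemma is_derive_sq_weighted (p q : R -> R) (t p' q' : R) :
  is_derive p t p' -> is_derive q t q' ->
  is_derive (fun t => t ^ 2 * (p t ^ 2 + q t ^ 2))%R t
    (2 * t * (p t ^ 2 + q t ^ 2) + t ^ 2 * (2 * p t * p' + 2 * q t * q'))%R.
Proof.
intros Dp Dq. auto_derive.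
- repeat split; eexists; eassumption.
- assert (Ep : Derive (fun s => p s) t = p') by now apply is_derive_unique.
  assert (Eq : Derive (fun s => q s) t = q') by now apply is_derive_unique.
  rewrite Ep, Eq. ring.
Qed.

(** For h = f' and p = 1 + z f''/f', the function t^2 |h(t z)|^2 of t in [0,1] has
    derivative 2 t |h|^2 Re p, which is nonnegative, also at the zeros of h, where it
    vanishes. It is thus nondecreasing, and it is positive for small t since h(0) = 1.
    The equation for h is stated away from the zeros of h because the quotient f''/f'
    has no meaning there. *)
Lemma nonvanishing_of_Re_log_derivative (h h1 p : C -> C) :
  (forall z, (Cmod z < 1)%R -> is_Cderive h z (h1 z)) -> h 0 = 1 ->
  (forall z, (Cmod z < 1)%R -> h z <> 0 -> z * h1 z = (p z - 1) * h z) ->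
  (forall z, (Cmod z < 1)%R -> (0 <= Re (p z))%R) ->
  forall z, (Cmod z < 1)%R -> h z <> 0.
Proof.
intros Hd H0 Heq Hp [x y] Hz Habs.
set (g := fun t : R => (t * x, t * y)%R : C).
assert (Eg : forall t, g t = RtoC t * (x, y)).
{ intros t. unfold g. apply injective_projections; simpl; ring. }
assert (Hg : forall t, (0 <= t <= 1)%R -> (Cmod (g t) < 1)%R).
{ intros t Ht. rewrite Eg. now apply Cmod_scale_lt. }
set (F := fun t : R => (t ^ 2 * (Re (h (g t)) ^ 2 + Im (h (g t)) ^ 2))%R).
set (F' := fun t : R => (2 * t * (Re (h (g t)) ^ 2 + Im (h (g t)) ^ 2)
   + t ^ 2 * (2 * Re (h (g t)) * Re (h1 (g t) * (x, y)) + 2 * Im (h (g t)) * Im (h1 (g t) * (x, y))))%R).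
assert (DF : forall t, (0 <= t <= 1)%R -> is_derive F t (F' t)).
{ intros t Ht.
  assert (D1 : is_derive (fun t => Re (h (g t))) t (Re (h1 (g t) * (x, y)))).
  { apply (derive_along_curve h (fun t => t * x)%R (fun t => t * y)%R).
    - auto_derive; auto; ring.
    - auto_derive; auto; ring.
    - apply (Hd (g t)), Hg, Ht. }
  assert (D2 : is_derive (fun t => Im (h (g t))) t (Im (h1 (g t) * (x, y)))).
  { apply (derive_along_curve_Im h (fun t => t * x)%R (fun t => t * y)%R).
    - auto_derive; auto; ring.
    - auto_derive; auto; ring.
    - apply (Hd (g t)), Hg, Ht. }
  unfold F, F'.
  exact (is_derive_sq_weighted _ _ t _ _ D1 D2). }
assert (PF : forall t, (0 <= t <= 1)%R -> (0 <= F' t)%R).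
{ intros t Ht. unfold F'.
  destruct (Ceq_dec (h (g t)) 0) as [E|E].
  - rewrite E. unfold Re, Im; simpl. right; ring.
  - specialize (Heq (g t) (Hg t Ht) E). specialize (Hp (g t) (Hg t Ht)).
    rewrite Eg in Heq at 1.
    assert (E1 : (t * Re (h1 (g t) * (x, y)) = Re ((p (g t) - 1) * h (g t)))%R).
    { rewrite <- Heq. unfold Re; simpl; ring. }
    assert (E2 : (t * Im (h1 (g t) * (x, y)) = Im ((p (g t) - 1) * h (g t)))%R).
    { rewrite <- Heq. unfold Im; simpl; ring. }
    replace (2 * t * (Re (h (g t)) ^ 2 + Im (h (g t)) ^ 2)
   + t ^ 2 * (2 * Re (h (g t)) * Re (h1 (g t) * (x, y)) + 2 * Im (h (g t)) * Im (h1 (g t) * (x, y))))%R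
    with (2 * t * (Re (h (g t)) ^ 2 + Im (h (g t)) ^ 2 + Re (h (g t)) * (t * Re (h1 (g t) * (x, y)))
      + Im (h (g t)) * (t * Im (h1 (g t) * (x, y)))))%R by ring.
    rewrite E1, E2.
    replace (2 * t * (Re (h (g t)) ^ 2 + Im (h (g t)) ^ 2 + Re (h (g t)) * Re ((p (g t) - 1) * h (g t)) +
      Im (h (g t)) * Im ((p (g t) - 1) * h (g t))))%R
     with (2 * t * Re (p (g t)) * (Re (h (g t)) ^ 2 + Im (h (g t)) ^ 2))%R.
    2: { destruct (p (g t)), (h (g t)); unfold Re, Im; simpl; ring. }
    apply Rmult_le_pos; [|nra]. nra. }
destruct (is_Cderive_continuous h 0 (h1 0) (Hd 0 ltac:(rewrite Cmod_0; lra))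
  (1 / 2)%R ltac:(lra)) as [del [Hdel K]].
set (t0 := Rmin (1 / 2) (del / 2)).
assert (Ht0 : (0 < t0 <= 1 / 2)%R).
{ split; [apply Rmin_glb_lt; lra|apply Rmin_l]. }
assert (Ht0' : (t0 <= del / 2)%R) by apply Rmin_r.
specialize (K (g t0)).
assert (N0 : h (g t0) <> 0).
{ intros E. rewrite E, H0 in K.
  replace (0 - 1) with (- RtoC 1) in K by ring. rewrite Cmod_opp, Cmod_1 in K.
  assert (1 < 1 / 2)%R; [apply K|lra].
  replace (g t0 - 0) with (RtoC t0 * (x, y)) by (rewrite Eg; ring).
  rewrite Cmod_mult, Cmod_R, Rabs_pos_eq by lra.
  pose proof (Cmod_ge_0 (x, y)). nra. }
destruct (MVT_gen F t0 1 F') as [c [Hc E]].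
- intros t Ht. rewrite Rmin_left, Rmax_right in Ht by lra. apply DF; lra.
- intros t Ht. rewrite Rmin_left, Rmax_right in Ht by lra.
  apply continuity_pt_filterlim. apply (ex_derive_continuous (V := R_NormedModule) F).
  eexists; apply DF; lra.
- rewrite Rmin_left, Rmax_right in Hc by lra.
  specialize (PF c ltac:(lra)).
  (* F is nondecreasing and positive at t0, so it cannot vanish at 1. *)
  assert (F1 : F 1%R = 0%R).
  { unfold F. assert (G1 : g 1%R = (x, y)) by (unfold g; now rewrite !Rmult_1_l).
    rewrite G1, Habs. unfold Re, Im; simpl; ring. }
  assert (F0 : (0 < F t0)%R).
  { unfold F. apply Rmult_lt_0_compat; [nra|].
    destruct (Req_dec (Re (h (g t0))) 0) as [e1|e1]; [|nra].
    destruct (Req_dec (Im (h (g t0))) 0) as [e2|e2]; [|nra].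
    exfalso; apply N0. apply injective_projections; assumption. }
  nra.
Qed.

(** * The Schwarz function of a member of the class *)

(** The exponential is invertible near 0 in a Lipschitz way; this turns an O(z^4)
    estimate between exponentials into one between exponents. *)
Lemma Cexp_lower : exists delta, (0 < delta)%R /\
  forall u, (Cmod u < delta)%R -> (Cmod u <= 2 * Cmod (Cexp u - 1))%R.
Proof.
destruct (proj1 (is_Cderive_eps _ _ _) (Cexp_derive 0) (1 / 2)%R ltac:(lra)) as [del [Hd K]].
exists del; split; [exact Hd|]. intros u Hu. specialize (K u).
replace (u - 0) with u in K by ring. rewrite Cexp_0 in K.
specialize (K Hu).
pose proof (Cmod_triangle_inv u (- (Cexp u - 1 - u * 1))) as T.
replace (u - - (Cexp u - 1 - u * 1)) with (Cexp u - 1) in T by ring.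
rewrite Cmod_opp in T. lra.
Qed.

Lemma jet_small (f : C -> C) (p0 p1 p2 p3 : C) : jet f p0 p1 p2 p3 ->
  forall eps, (0 < eps)%R -> exists delta, (0 < delta)%R /\
  forall z, (Cmod z < delta)%R -> (Cmod (f z - p0) < eps)%R.
Proof.
intros [M [d [Hd H]]] eps He.
set (B := (Rabs M + (Cmod p1 + Cmod p2 + Cmod p3 + Cmod 0) + 1)%R).
assert (HB : (0 < B)%R).
{ unfold B. pose proof (Rabs_pos M). pose proof (Cmod_ge_0 p1). pose proof (Cmod_ge_0 p2).
  pose proof (Cmod_ge_0 p3). pose proof (Cmod_ge_0 0). lra. }
exists (Rmin (Rmin 1 d) (eps / B)). split.
{ repeat apply Rmin_glb_lt; try lra. now apply Rdiv_lt_0_compat. }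
intros z Hz.
pose proof (Rmin_l (Rmin 1 d) (eps / B)). pose proof (Rmin_r (Rmin 1 d) (eps / B)).
pose proof (Rmin_l 1 d). pose proof (Rmin_r 1 d).
specialize (H z ltac:(lra)). pose proof (Cmod_ge_0 z).
pose proof (poly_bound p1 p2 p3 0 z ltac:(lra)) as P.
replace (f z - p0) with ((f z - (p0 + p1 * z + p2 * z ^ 2 + p3 * z ^ 3)) + z *
  (p1 + p2 * z + p3 * z ^ 2 + 0 * z ^ 3)) by ring.
apply Rle_lt_trans with (1 := Cmod_triangle _ _). rewrite Cmod_mult.
assert (Z4 : (Cmod z ^ 4 <= Cmod z)%R).
{ replace (Cmod z ^ 4)%R with (Cmod z * Cmod z ^ 3)%R by ring.
  rewrite <- (Rmult_1_r (Cmod z)) at 3. apply Rmult_le_compat_l; [lra|].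
  rewrite <- (pow1 3). apply pow_incr; lra. }
assert (M * Cmod z ^ 4 <= Rabs M * Cmod z)%R.
{ apply Rle_trans with (Rabs M * Cmod z ^ 4)%R.
  - apply Rmult_le_compat_r; [now apply pow_le|apply Rle_abs].
  - apply Rmult_le_compat_l; [apply Rabs_pos|exact Z4]. }
assert (Cmod z * B < eps)%R.
{ apply Rlt_le_trans with (eps / B * B)%R; [apply Rmult_lt_compat_r; lra|right; field; lra]. }
unfold B in *. nra.
Qed.

(** With Q the cubic polynomial of the claimed coefficients, the jets of e^Q h and of
    h + k agree. So e^omega - e^Q = O(z^4), and [Cexp_lower] applies to omega - Q,
    which is small because omega is continuous at 0. *)
Lemma jet_of_exp_equation (omega h k : C -> C) (d a2 a3 a4 : C) :
  is_Cderive omega 0 d -> omega 0 = 0 ->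
  jet h 1 (2 * a2) (3 * a3) (4 * a4) -> jet k 0 (2 * a2) (6 * a3) (12 * a4) ->
  (forall z, (Cmod z < 1)%R -> Cexp (omega z) * h z = h z + k z) ->
  jet omega 0 (2 * a2) (6 * a3 - 6 * a2 ^ 2) (12 * a4 - 30 * a2 * a3 + 56 / 3 * a2 ^ 3).
Proof.
intros Hom Hom0 Jh Jk Heq.
set (c1 := 2 * a2). set (c2 := 6 * a3 - 6 * a2 ^ 2).
set (c3 := 12 * a4 - 30 * a2 * a3 + 56 / 3 * a2 ^ 3).
set (Q := fun z => c1 * z + c2 * z ^ 2 + c3 * z ^ 3).
pose proof (jet_mult (jet_Cexp_poly c1 c2 c3) Jh) as J1.
pose proof (jet_mult (jet_poly (- (1)) 0 0 0) (jet_plus Jh Jk)) as J2.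
pose proof (jet_plus J1 J2) as J3. clear J1 J2.
apply (jet_congr _ _ _ _ _ 0 0 0 0) in J3.
2: ring.
2: unfold c1; ring.
2: { unfold c1, c2. field. }
2: { unfold c1, c2, c3. field. }
destruct J3 as [M [d1 [Hd1 B]]].
destruct (jet_small _ _ _ _ _ Jh (1 / 2)%R ltac:(lra)) as [d2 [Hd2 Kh]].
destruct (jet_small _ _ _ _ _ (jet_Cexp_poly c1 c2 c3) (1 / 2)%R ltac:(lra)) as [d3 [Hd3 KQ]].
destruct Cexp_lower as [d4 [Hd4 KL]].
destruct (is_Cderive_continuous _ _ _ Hom (d4 / 2)%R ltac:(lra)) as [d5 [Hd5 Kom]].
destruct (jet_small _ _ _ _ _ (jet_poly 0 c1 c2 c3) (d4 / 2)%R ltac:(lra)) as [d6 [Hd6 KQ0]].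
(* The factor 8 is 2 from the inverse of the exponential, 2 from 1/|h| and 2 from
    1/|e^Q|. *)
exists (8 * Rabs M)%R, (Rmin 1 (Rmin (Rmin d1 d2) (Rmin d3 (Rmin d5 d6)))). split.
{ repeat apply Rmin_glb_lt; lra. }
intros z Hz.
pose proof (Rmin_l 1 (Rmin (Rmin d1 d2) (Rmin d3 (Rmin d5 d6)))).
pose proof (Rmin_r 1 (Rmin (Rmin d1 d2) (Rmin d3 (Rmin d5 d6)))).
pose proof (Rmin_l (Rmin d1 d2) (Rmin d3 (Rmin d5 d6))).
pose proof (Rmin_r (Rmin d1 d2) (Rmin d3 (Rmin d5 d6))).
pose proof (Rmin_l d1 d2). pose proof (Rmin_r d1 d2).
pose proof (Rmin_l d3 (Rmin d5 d6)). pose proof (Rmin_r d3 (Rmin d5 d6)).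
pose proof (Rmin_l d5 d6). pose proof (Rmin_r d5 d6).
specialize (B z ltac:(lra)). specialize (Kh z ltac:(lra)). specialize (KQ z ltac:(lra)).
specialize (Kom z). replace (z - 0) with z in Kom by ring. specialize (Kom ltac:(lra)).
specialize (KQ0 z ltac:(lra)). specialize (Heq z ltac:(lra)).
rewrite Hom0 in Kom.
replace (omega z - 0) with (omega z) in Kom by ring.
replace (0 + c1 * z + c2 * z ^ 2 + c3 * z ^ 3 - 0) with (Q z) in KQ0 by (unfold Q; ring).
fold (Q z) in KQ. fold (Q z) in B.
replace (0 + c1 * z + c2 * z ^ 2 + c3 * z ^ 3) with (Q z) by (unfold Q; ring).
assert (Hh : (1 / 2 <= Cmod (h z))%R).
{ pose proof (Cmod_triangle_inv 1 (- (h z - 1))) as T.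
  replace (1 - - (h z - 1)) with (h z) in T by ring. rewrite Cmod_opp, Cmod_1 in T. lra. }
assert (HQ : (1 / 2 <= Cmod (Cexp (Q z)))%R).
{ pose proof (Cmod_triangle_inv 1 (- (Cexp (Q z) - 1))) as T.
  replace (1 - - (Cexp (Q z) - 1)) with (Cexp (Q z)) in T by ring.
  rewrite Cmod_opp, Cmod_1 in T. lra. }
assert (HL : (Cmod (omega z - Q z) <= 2 * Cmod (Cexp (omega z - Q z) - 1))%R).
{ apply KL. pose proof (Cmod_triangle (omega z) (- Q z)) as T. rewrite Cmod_opp in T.
  unfold Cminus. lra. }
set (X := Cmod (Cexp (omega z - Q z) - 1)) in *.
assert (HX : (Cmod (Cexp (Q z)) * X * Cmod (h z) <= Rabs M * Cmod z ^ 4)%R).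
{ unfold X. rewrite <- !Cmod_mult.
  apply Rle_trans with (M * Cmod z ^ 4)%R.
  - rewrite <- Cmod_opp. refine (Rle_trans _ _ _ (Req_le _ _ _) B). f_equal.
    replace (Cexp (Q z) * (Cexp (omega z - Q z) - 1)) with (Cexp (omega z) - Cexp (Q z)).
    + replace ((Cexp (omega z) - Cexp (Q z)) * h z) with (h z + k z - Cexp (Q z) * h z) by
        (rewrite <- Heq; ring).
      ring.
    + replace (omega z) with (Q z + (omega z - Q z)) at 1 by ring. rewrite Cexp_plus. ring.
  - apply Rmult_le_compat_r; [apply pow_le, Cmod_ge_0|apply Rle_abs]. }
pose proof (Cmod_ge_0 (Cexp (omega z - Q z) - 1)) as HX0. fold X in HX0.
assert (X * (1 / 4) <= Cmod (Cexp (Q z)) * X * Cmod (h z))%R.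
{ replace (Cmod (Cexp (Q z)) * X * Cmod (h z))%R with (X * (Cmod (Cexp (Q z)) * Cmod (h z)))%R by ring.
  apply Rmult_le_compat_l; [exact HX0|]. nra. }
lra.
Qed.

(** Holomorphic functions with a differentiable derivative: the continuity of the
    derivative, needed for differentiation under the integral sign, is then automatic,
    and the notion is closed under the field operations. *)
Definition twice_derivable_on (U : C -> Prop) (G : C -> C) : Prop :=
  exists G1, forall z, U z -> is_Cderive G z (G1 z) /\ exists d, is_Cderive G1 z d.

(** The chain rule for e^omega = 1 + z f''/f' expresses the derivative of omega
    through f', f'', f''' and omega itself, all of which are differentiable. *)
Lemma class_Ce_schwarz_function (f : C -> C) (a : nat -> C) :
  class_Ce f -> power_series_on_disk f a ->
  exists omega : C -> C,
    (forall z, (Cmod z < 1)%R -> (Cmod (omega z) < 1)%R) /\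
    twice_derivable_on (fun z => (Cmod z < 1)%R) omega /\
    jet omega 0 (2 * a 2%nat) (6 * a 3%nat - 6 * a 2%nat ^ 2)
      (12 * a 4%nat - 30 * a 2%nat * a 3%nat + 56 / 3 * a 2%nat ^ 3).
Proof.
intros [[Hf [_ [Hf0 Hf1]]] [omega [Han [Hdisk [Hom0 Hsub]]]]] Ha.
assert (Ha' : forall z, (Cmod z < 1)%R -> is_Cseries (fun n => a n * z ^ n) (f z)).
{ intros z Hz. apply is_Cseries_of_pseries, Ha, Hz. }
pose proof (abs_conv_of_is_Cseries f a 1 Ha') as A0.
pose proof (abs_conv_derive _ _ A0) as A1.
pose proof (abs_conv_derive _ _ A1) as A2.
pose proof (abs_conv_derive _ _ A2) as A3.
set (h := CPSeries (coef_derive a)). set (h1 := CPSeries (coef_derive (coef_derive a))).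
set (h2 := CPSeries (coef_derive (coef_derive (coef_derive a)))).
assert (Dh : forall z, (Cmod z < 1)%R -> is_Cderive h z (h1 z)) by (intros; now apply (CPSeries_derive _ 1)).
assert (Dh1 : forall z, (Cmod z < 1)%R -> is_Cderive h1 z (h2 z)) by (intros; now apply (CPSeries_derive _ 1)).
assert (Dh2 : forall z, (Cmod z < 1)%R -> exists d, is_Cderive h2 z d) by
  (intros; eexists; now apply (CPSeries_derive _ 1)).
assert (Near : forall z w, (Cmod z < 1)%R -> (Cmod (w - z) < 1 - Cmod z)%R -> (Cmod w < 1)%R).
{ intros z w Hz Hw. pose proof (Cmod_triangle_inv w z). lra. }
assert (F1 : forall z, (Cmod z < 1)%R -> C_derive f z = h z).
{ intros z Hz. apply is_C_derive_unique. change (is_Cderive f z (h z)).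
  apply is_Cderive_ext_loc with (CPSeries a) (1 - Cmod z)%R; [lra| |now apply (CPSeries_derive _ 1)].
  intros w Hw. apply CPSeries_eq, Ha', (Near z); auto. }
assert (F2 : forall z, (Cmod z < 1)%R -> C_derive (C_derive f) z = h1 z).
{ intros z Hz. apply is_C_derive_unique. change (is_Cderive (C_derive f) z (h1 z)).
  apply is_Cderive_ext_loc with h (1 - Cmod z)%R; [lra| |now apply Dh].
  intros w Hw. symmetry. apply F1, (Near z); auto. }
assert (Z0 : (Cmod 0 < 1)%R) by (rewrite Cmod_0; lra).
assert (H0 : h 0 = 1) by (rewrite <- F1; auto).
assert (Ea1 : a 1%nat = 1).
{ unfold h in H0. rewrite (CPSeries_0 _ 1 A1 Rlt_0_1) in H0. unfold coef_derive in H0.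
  simpl INR in H0.
  rewrite <- H0. ring. }
assert (E1 : forall z, (Cmod z < 1)%R -> 1 + z * h1 z / h z = Cexp (omega z)).
{ intros z Hz. rewrite <- Hsub by exact Hz. rewrite F1, F2 by exact Hz. reflexivity. }
assert (NZ : forall z, (Cmod z < 1)%R -> h z <> 0).
{ apply (nonvanishing_of_Re_log_derivative h h1 (fun z => Cexp (omega z))); auto.
  - intros z Hz Hnz. rewrite <- E1 by exact Hz. field. exact Hnz.
  - intros z Hz. apply Re_Cexp_pos. apply Hdisk, Hz. }
exists omega. split; [|split].
- intros z Hz. apply Hdisk, Hz.
- set (P1 := fun z => (h1 z + z * h2 z) * / h z + (z * h1 z) * (- h1 z * / (h z * h z))).
  exists (fun z => P1 z * Cexp (- omega z)).
  assert (Dom : forall z, (Cmod z < 1)%R -> is_Cderive omega z (P1 z * Cexp (- omega z))).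
  { intros z Hz. destruct (Han z Hz) as [d Hd]. change (is_Cderive omega z d) in Hd.
    apply is_Cderive_congr with (2 := Hd).
    assert (E : d * Cexp (omega z) = P1 z).
    { apply (is_Cderive_unique (fun w => Cexp (omega w)) z).
      - apply (is_Cderive_comp Cexp omega); [apply Cexp_derive|exact Hd].
      - apply is_Cderive_ext_loc with (fun w => 1 + (w * h1 w) * / h w) (1 - Cmod z)%R; [lra| |].
        + intros w Hw. apply E1, (Near z); auto.
        + apply is_Cderive_congr with (0 + ((1 * h1 z + z * h2 z) * / h z + (z * h1 z) *
            (- h1 z / (h z * h z)))).
          * unfold P1. field. now apply NZ.
          * apply (is_Cderive_plus (fun _ => 1)); [apply is_Cderive_const|].
            apply (is_Cderive_mult (fun w => w * h1 w) (fun w => / h w)).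
            -- apply (is_Cderive_mult (fun w => w) h1); [apply is_Cderive_id|now apply Dh1].
            -- apply is_Cderive_inv; auto. }
    rewrite <- E, <- Cmult_assoc, <- Cexp_plus.
    replace (omega z + - omega z) with (RtoC 0) by ring. rewrite Cexp_0. symmetry.
    apply Cmult_1_r. }
  intros z Hz. split; [now apply Dom|].
  destruct (Dh2 z Hz) as [d2 D2].
  eexists. apply (is_Cderive_mult P1 (fun w => Cexp (- omega w))).
  + unfold P1.
    apply (is_Cderive_plus (fun w => (h1 w + w * h2 w) * / h w) (fun w => (w * h1 w) *
      (- h1 w * / (h w * h w)))).
    * apply (is_Cderive_mult (fun w => h1 w + w * h2 w) (fun w => / h w)).
      -- apply (is_Cderive_plus h1 (fun w => w * h2 w)); [now apply Dh1|].
         apply (is_Cderive_mult (fun w => w) h2); [apply is_Cderive_id|exact D2].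
      -- apply is_Cderive_inv; auto.
    * apply (is_Cderive_mult (fun w => w * h1 w) (fun w => - h1 w * / (h w * h w))).
      -- apply (is_Cderive_mult (fun w => w) h1); [apply is_Cderive_id|now apply Dh1].
      -- apply (is_Cderive_mult (fun w => - h1 w) (fun w => / (h w * h w))).
         ++ apply (is_Cderive_comp (fun w => - w) h1); [apply is_Cderive_opp_id|now apply Dh1].
         ++ apply (is_Cderive_inv (fun w => h w * h w)).
            ** apply Cmult_neq_0; auto.
            ** apply (is_Cderive_mult h h); now apply Dh.
  + apply (is_Cderive_comp Cexp (fun w => - omega w)); [apply Cexp_derive|].
    apply (is_Cderive_comp (fun w => - w) omega); [apply is_Cderive_opp_id|now apply Dom].
- destruct (Han 0 Z0) as [d Hd].
  apply (jet_of_exp_equation omega h (fun z => z * h1 z) d); auto.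
  + pose proof (jet_CPSeries _ 1 A1 Rlt_0_1) as J. fold h in J. unfold coef_derive in J.
    simpl INR in J.
    rewrite Ea1 in J. apply (jet_congr _ _ _ _ _ _ _ _ _) with (5 := J); rewrite ?RtoC_plus; ring.
  + pose proof (jet_mult (jet_poly 0 1 0 0) (jet_CPSeries _ 1 A2 Rlt_0_1)) as J.
    fold h1 in J. unfold coef_derive in J. simpl INR in J.
    apply (jet_ext _ (fun z => z * h1 z) _ _ _ _ 1 Rlt_0_1) in J; [|intros; ring].
    apply (jet_congr _ _ _ _ _ _ _ _ _) with (5 := J); rewrite ?RtoC_plus; ring.
  + intros z Hz. rewrite <- E1 by exact Hz. field. now apply NZ.
Qed.

(** * Integrals over circles *)

Definition circle_pt (u t : R) : C := (u * cos t, u * sin t)%R.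

Lemma circle_pt_polar (u t : R) : circle_pt u t = RtoC u * (cos t, sin t).
Proof. unfold circle_pt. apply injective_projections; simpl; ring. Qed.

Lemma Cmod_cis (t : R) : Cmod (cos t, sin t) = 1%R.
Proof.
unfold Cmod; simpl fst; simpl snd. rewrite <- sqrt_1. f_equal.
pose proof (sin2_cos2 t) as T. unfold Rsqr in T. rewrite <- T. ring.
Qed.

Lemma Cmod_circle_pt (u t : R) : (0 <= u)%R -> Cmod (circle_pt u t) = u.
Proof.
intros Hu. rewrite circle_pt_polar, Cmod_mult, Cmod_cis, Cmod_R, Rabs_pos_eq by exact Hu. ring.
Qed.

Lemma derive_circ_angle (G : C -> C) (u t : R) (d : C) : is_Cderive G (circle_pt u t) d ->
  is_derive (fun s => Re (G (circle_pt u s))) t (- u * Im (d * (cos t, sin t)))%R /\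
  is_derive (fun s => Im (G (circle_pt u s))) t (u * Re (d * (cos t, sin t)))%R.
Proof.
intros H. split.
- replace (- u * Im (d * (cos t, sin t)))%R with (Re (d * (- (u * sin t), u * cos t)%R)).
  2: { destruct d; unfold Re, Im; simpl; ring. }
  apply (derive_along_curve G (fun s => u * cos s)%R (fun s => u * sin s)%R); [| |exact H].
  + auto_derive; auto; ring.
  + auto_derive; auto; ring.
- replace (u * Re (d * (cos t, sin t)))%R with (Im (d * (- (u * sin t), u * cos t)%R)).
  2: { destruct d; unfold Re, Im; simpl; ring. }
  apply (derive_along_curve_Im G (fun s => u * cos s)%R (fun s => u * sin s)%R); [| |exact H].
  + auto_derive; auto; ring.
  + auto_derive; auto; ring.
Qed.

Lemma derive_circ_radius (G : C -> C) (u t : R) (d : C) : is_Cderive G (circle_pt u t) d ->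
  is_derive (fun s => Re (G (circle_pt s t))) u (Re (d * (cos t, sin t))).
Proof.
intros H.
apply (derive_along_curve G (fun s => s * cos t)%R (fun s => s * sin t)%R); [| |exact H].
- auto_derive; auto; ring.
- auto_derive; auto; ring.
Qed.

Lemma continuity_2d_circ (P : C -> R) (u t : R) :
  (forall eps, (0 < eps)%R -> exists delta, (0 < delta)%R /\
     forall w, (Cmod (w - circle_pt u t) < delta)%R -> (Rabs (P w - P (circle_pt u t)) < eps)%R) ->
  continuity_2d_pt (fun u t => P (circle_pt u t)) u t.
Proof.
intros H eps. destruct (H eps (cond_pos eps)) as [del [Hd K]].
assert (C1 : continuity_2d_pt (fun u t => u * cos t)%R u t).
{ apply continuity_2d_pt_mult; [apply continuity_2d_pt_id1|].
  apply continuity_1d_2d_pt_comp; [apply continuity_cos|apply continuity_2d_pt_id2]. }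
assert (C2 : continuity_2d_pt (fun u t => u * sin t)%R u t).
{ apply continuity_2d_pt_mult; [apply continuity_2d_pt_id1|].
  apply continuity_1d_2d_pt_comp; [apply continuity_sin|apply continuity_2d_pt_id2]. }
assert (Hd2 : (0 < del / 2)%R) by lra.
pose proof (locally_2d_and _ _ _ _ (C1 (mkposreal _ Hd2)) (C2 (mkposreal _ Hd2))) as L.
apply locally_2d_impl with (2 := L). apply locally_2d_forall.
intros v s [L1 L2]. simpl in L1, L2. apply K.
apply Rle_lt_trans with (1 := Cmod_le_sum _). unfold circle_pt, Re, Im; simpl.
unfold Rminus in L1, L2. lra.
Qed.

Definition punctured_disk (z : C) : Prop := (0 < Cmod z < 1)%R.

Lemma ex_RInt_circ (G : C -> C) (u : R) : (0 <= u)%R ->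
  (forall z, Cmod z = u -> exists d, is_Cderive G z d) ->
  ex_RInt (fun t => Re (G (circle_pt u t))) 0 (2 * PI).
Proof.
intros Hu H. apply (@ex_RInt_continuous R_CompleteNormedModule). intros t _.
destruct (H (circle_pt u t) (Cmod_circle_pt u t Hu)) as [d Hd].
apply (ex_derive_continuous (V := R_NormedModule) (fun s => Re (G (circle_pt u s)))).
eexists. apply (proj1 (derive_circ_angle G u t d Hd)).
Qed.

(** The radial derivative of the mean is the mean of G'(z) z/|z|, whose real part is,
    up to the factor 1/|z|, the angular derivative of Im G; its integral over a full
    turn is zero. So the mean does not depend on the radius, and it tends to 0 with
    the radius. *)
Lemma circle_integral_zero (G : C -> C) (r : R) :
  twice_derivable_on punctured_disk G ->
  (forall eps, (0 < eps)%R -> exists delta, (0 < delta)%R /\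
     forall z, (0 < Cmod z < delta)%R -> (Cmod (G z) < eps)%R) ->
  (0 < r < 1)%R ->
  RInt (fun t => Re (G (circle_pt r t))) 0 (2 * PI) = 0%R.
Proof.
intros [G1 HG] Hlim Hr.
set (M := fun u => RInt (fun t => Re (G (circle_pt u t))) 0 (2 * PI)).
assert (Pd : forall u t, (0 < u < 1)%R -> punctured_disk (circle_pt u t)).
{ intros u t Hu. unfold punctured_disk. rewrite Cmod_circle_pt; lra. }
assert (Loc : forall u, (0 < u < 1)%R -> locally u (fun v : R => (0 < v < 1)%R)).
{ intros u Hu. assert (He : (0 < Rmin u (1 - u))%R) by (apply Rmin_glb_lt; lra).
  exists (mkposreal _ He). intros v Hv. change (Rabs (v - u) < Rmin u (1 - u))%R in Hv.
  pose proof (Rmin_l u (1 - u)). pose proof (Rmin_r u (1 - u)). apply Rabs_def2 in Hv. lra. }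
assert (Ex : forall u, (0 < u < 1)%R -> ex_RInt (fun t => Re (G (circle_pt u t))) 0 (2 * PI)).
{ intros u Hu. apply ex_RInt_circ; [lra|]. intros z Hz. exists (G1 z). apply HG.
  unfold punctured_disk; lra. }
assert (Drad : forall u t, (0 < u < 1)%R ->
   is_derive (fun s => Re (G (circle_pt s t))) u (Re (G1 (circle_pt u t) * (cos t, sin t)))).
{ intros u t Hu. apply derive_circ_radius, HG, Pd, Hu. }
assert (DM : forall u, (0 < u < 1)%R -> is_derive M u 0%R).
{ intros u Hu.
  replace 0%R with (RInt (fun t => Derive (fun v => Re (G (circle_pt v t))) u) 0 (2 * PI)).
  - apply (is_derive_RInt_param (fun v t => Re (G (circle_pt v t)))).
    + apply filter_imp with (2 := Loc u Hu). intros v Hv t _. eexists. now apply Drad.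
    + intros t _.
      apply continuity_2d_pt_ext_loc with (fun v s => (Re (G1 (circle_pt v s)) * cos s - Im (G1
        (circle_pt v s)) * sin s)%R).
      * destruct (Loc u Hu) as [e He]. exists e. intros v s Hv _. symmetry.
        apply is_derive_unique.
        replace (Re (G1 (circle_pt v s)) * cos s - Im (G1 (circle_pt v s)) * sin s)%R with (Re
          (G1 (circle_pt v s) * (cos s, sin s))).
        -- apply Drad, He, Hv.
        -- unfold Re, Im; simpl; ring.
      * destruct (HG (circle_pt u t) (Pd u t Hu)) as [_ [d Hd]].
        apply continuity_2d_pt_minus; apply continuity_2d_pt_mult.
        -- apply (continuity_2d_circ (fun w => Re (G1 w))). intros eps He.
           destruct (is_Cderive_continuous _ _ _ Hd eps He) as [del [Hdel K]].
           exists del; split; [exact Hdel|]. intros w Hw.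
           apply Rle_lt_trans with (2 := K w Hw). apply Rle_trans with (2 := re_le_Cmod _).
           right; f_equal.
        -- apply continuity_1d_2d_pt_comp; [apply continuity_cos|apply continuity_2d_pt_id2].
        -- apply (continuity_2d_circ (fun w => Im (G1 w))). intros eps He.
           destruct (is_Cderive_continuous _ _ _ Hd eps He) as [del [Hdel K]].
           exists del; split; [exact Hdel|]. intros w Hw.
           apply Rle_lt_trans with (2 := K w Hw). apply Rle_trans with (2 := Rmax_Cmod _).
           apply Rle_trans with (2 := Rmax_r _ _). right; f_equal.
        -- apply continuity_1d_2d_pt_comp; [apply continuity_sin|apply continuity_2d_pt_id2].
    + apply filter_imp with (2 := Loc u Hu). intros v Hv. now apply Ex.
  - apply is_RInt_unique.
    apply is_RInt_ext with (fun t => Re (G1 (circle_pt u t) * (cos t, sin t))).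
    { intros t _. symmetry. apply is_derive_unique, Drad, Hu. }
    assert (Z : minus (/ u * Im (G (circle_pt u (2 * PI))))%R (/ u * Im (G (circle_pt u 0)))%R = 0%R).
    { unfold circle_pt. rewrite cos_2PI, sin_2PI, cos_0, sin_0.
      exact (minus_eq_zero (G := R_AbelianGroup) _). }
    refine (eq_rect _ (is_RInt (V := R_NormedModule) _ 0 (2 * PI)%R) _ _ Z).
    apply (@is_RInt_derive R_CompleteNormedModule (fun t => / u * Im (G (circle_pt u t)))%R).
    + intros t _.
      replace (Re (G1 (circle_pt u t) * (cos t, sin t))) with (/ u * (u * Re (G1
        (circle_pt u t) * (cos t, sin t))))%R.
      2: { field; lra. }
      apply is_derive_scal. apply (derive_circ_angle G). now apply HG, Pd.
    + intros t _. destruct (HG (circle_pt u t) (Pd u t Hu)) as [_ [d Hd]].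
      destruct (derive_circ_angle G1 u t d Hd) as [A B].
      apply (ex_derive_continuous (V := R_NormedModule)).
      apply ex_derive_ext with (fun t => (Re (G1 (circle_pt u t)) * cos t - Im (G1 (circle_pt u t)) * sin t)%R).
      { intros s. unfold Re, Im; simpl; ring. }
      apply @ex_derive_minus; apply ex_derive_mult.
      * eexists; exact A.
      * auto_derive; auto.
      * eexists; exact B.
      * auto_derive; auto. }
assert (Const : forall s, (0 < s <= r)%R -> M s = M r).
{ intros s Hs. destruct (MVT_gen M s r (fun _ => 0%R)) as [c [_ E]].
  - intros v Hv. rewrite Rmin_left, Rmax_right in Hv by lra. apply DM; lra.
  - intros v Hv. rewrite Rmin_left, Rmax_right in Hv by lra.
    apply continuity_pt_filterlim, (ex_derive_continuous (V := R_NormedModule) M).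
    eexists; apply DM; lra.
  - lra. }
change (M r = 0%R).
destruct (Req_dec (M r) 0) as [|Hne]; [assumption|exfalso].
pose proof PI_RGT_0 as HPI.
assert (He : (0 < Rabs (M r) / (4 * PI))%R).
{ apply Rdiv_lt_0_compat; [now apply Rabs_pos_lt|lra]. }
destruct (Hlim _ He) as [del [Hdel K]].
(* A radius at which the mean is known to be small. *)
set (s := Rmin r (del / 2)).
assert (Hs : (0 < s <= r)%R) by (split; [apply Rmin_glb_lt; lra|apply Rmin_l]).
assert (Hs' : (s <= del / 2)%R) by apply Rmin_r.
assert (B : (Rabs (M s) <= (2 * PI - 0) * (Rabs (M r) / (4 * PI)))%R).
{ apply abs_RInt_le_const; [lra|apply Ex; lra|].
  intros t _. left. apply Rle_lt_trans with (1 := re_le_Cmod _). apply K.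
  rewrite Cmod_circle_pt; lra. }
rewrite (Const s Hs) in B.
replace ((2 * PI - 0) * (Rabs (M r) / (4 * PI)))%R with (Rabs (M r) / 2)%R in B by (field; lra).
pose proof (Rabs_pos_lt _ Hne). lra.
Qed.

(** * The Toeplitz matrix of a Schwarz function *)

Lemma twice_derivable_mult (U : C -> Prop) (f g : C -> C) :
  twice_derivable_on U f -> twice_derivable_on U g -> twice_derivable_on U (fun z => f z * g z).
Proof.
intros [f1 Hf] [g1 Hg]. exists (fun z => f1 z * g z + f z * g1 z).
intros z Hz. destruct (Hf z Hz) as [F [f2 F2]]. destruct (Hg z Hz) as [G [g2 G2]]. split.
- now apply is_Cderive_mult.
- eexists.
  apply (is_Cderive_plus (fun z => f1 z * g z) (fun z => f z * g1 z)); apply is_Cderive_mult; eassumption.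
Qed.

Lemma twice_derivable_plus (U : C -> Prop) (f g : C -> C) :
  twice_derivable_on U f -> twice_derivable_on U g -> twice_derivable_on U (fun z => f z + g z).
Proof.
intros [f1 Hf] [g1 Hg]. exists (fun z => f1 z + g1 z).
intros z Hz. destruct (Hf z Hz) as [F [f2 F2]]. destruct (Hg z Hz) as [G [g2 G2]]. split.
- now apply is_Cderive_plus.
- eexists. apply is_Cderive_plus; eassumption.
Qed.

Lemma twice_derivable_const (U : C -> Prop) (c : C) : twice_derivable_on U (fun _ => c).
Proof. exists (fun _ => 0). intros; split; [|exists 0]; apply is_Cderive_const. Qed.

Lemma twice_derivable_id (U : C -> Prop) : twice_derivable_on U (fun z => z).
Proof. exists (fun _ => 1).
intros; split; [apply is_Cderive_id|exists 0; apply is_Cderive_const]. Qed.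

Lemma twice_derivable_inv (U : C -> Prop) (f : C -> C) :
  (forall z, U z -> f z <> 0) -> twice_derivable_on U f -> twice_derivable_on U (fun z => / f z).
Proof.
intros H0 [f1 Hf]. exists (fun z => (- (1) * f1 z) * / (f z * f z)).
intros z Hz. destruct (Hf z Hz) as [F [f2 F2]]. split.
- apply is_Cderive_congr with (- f1 z / (f z * f z)); [unfold Cdiv; ring|].
  apply is_Cderive_inv; auto.
- eexists. apply (is_Cderive_mult (fun z => - (1) * f1 z) (fun z => / (f z * f z))).
  + apply (is_Cderive_mult (fun _ => - (1)) f1); [apply is_Cderive_const|exact F2].
  + apply (is_Cderive_inv (fun z => f z * f z)); [apply Cmult_neq_0; auto|].
    apply (is_Cderive_mult f f _ _ _ F F).
Qed.

Lemma twice_derivable_sub (U V : C -> Prop) (f : C -> C) :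
  (forall z, U z -> V z) -> twice_derivable_on V f -> twice_derivable_on U f.
Proof. intros H [f1 Hf]. exists f1. intros z Hz. apply Hf, H, Hz. Qed.

(** The last term collects the frequencies 1 and 2, which have zero mean over circles:
    this is Parseval's identity for a quadratic polynomial before integration. *)
Lemma Cmod_sqr_quadratic (x y w z : C) :
  (Cmod (x + y * z + w * z ^ 2) ^ 2 =
   Cmod x ^ 2 + Cmod y ^ 2 * Cmod z ^ 2 + Cmod w ^ 2 * (Cmod z ^ 2) ^ 2
   + 2 * Re (Cconj x * (y * z + w * z ^ 2) + Cconj y * w * RtoC (Cmod z ^ 2) * z))%R.
Proof.
rewrite !Cmod2_alt. destruct x, y, w, z. unfold Re, Im; simpl. ring.
Qed.

Lemma Cmod_sqr_plus (a b : C) : (Cmod (a + b) ^ 2 = Cmod a ^ 2 + Cmod b ^ 2 + 2 * Re (Cconj a * b))%R.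
Proof. rewrite !Cmod2_alt. destruct a, b. unfold Re, Im; simpl. ring. Qed.

(** On a circle conjugation agrees with a holomorphic function, which makes inner
    products accessible to [circle_integral_zero]. *)
Lemma Cconj_on_circle (z : C) (r : R) : (0 < r)%R -> Cmod z = r -> RtoC (r ^ 2) * / z = Cconj z.
Proof.
intros Hr Hz. assert (Hz0 : z <> 0) by (apply Cmod_gt_0; lra).
assert (E : RtoC (r ^ 2) = z * Cconj z).
{ rewrite <- Hz, Cmod2_alt. destruct z. unfold Re, Im. apply injective_projections; simpl; ring. }
rewrite E. field. exact Hz0.
Qed.

Lemma twice_derivable_ext (U : C -> Prop) (f g : C -> C) :
  (forall z, f z = g z) -> twice_derivable_on U f -> twice_derivable_on U g.
Proof.
intros E [f1 Hf]. exists f1. intros z Hz. destruct (Hf z Hz) as [F F2]. split; [|exact F2].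
apply is_Cderive_ext_loc with f 1%R; [lra|intros; apply E|exact F].
Qed.

Lemma twice_derivable_quadratic (U : C -> Prop) (a b c : C) : twice_derivable_on U
  (fun z => a + z * (b + z * c)).
Proof.
apply (twice_derivable_plus U (fun _ => a)); [apply twice_derivable_const|].
apply (twice_derivable_mult U (fun z => z)); [apply twice_derivable_id|].
apply (twice_derivable_plus U (fun _ => b)); [apply twice_derivable_const|].
apply (twice_derivable_mult U (fun z => z)); [apply twice_derivable_id|apply twice_derivable_const].
Qed.

(** Integrate |q|^2 + 2 Re (conj(q) H) <= |omega p|^2 <= |p|^2 over the circle of
    radius r, where p = x + y z + w z^2 and omega p = q + H. Up to constants both
    sides are real parts of functions that are holomorphic on the punctured disk and
    vanish at 0: on the circle, conj(q) is a polynomial of degree 3 in 1/z, while H is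
    O(z^4). *)
Lemma toeplitz_radius (omega : C -> C) (c1 c2 c3 x y w : C) (r : R) :
  (forall z, (Cmod z < 1)%R -> (Cmod (omega z) < 1)%R) ->
  twice_derivable_on (fun z => (Cmod z < 1)%R) omega -> jet omega 0 c1 c2 c3 -> (0 < r < 1)%R ->
  (r ^ 2 * (Cmod (c1 * x) ^ 2 + Cmod (c2 * x + c1 * y) ^ 2 * r ^ 2
    + Cmod (c3 * x + c2 * y + c1 * w) ^ 2 * (r ^ 2) ^ 2)
   <= Cmod x ^ 2 + Cmod y ^ 2 * r ^ 2 + Cmod w ^ 2 * (r ^ 2) ^ 2)%R.
Proof.
intros Hb Hom J Hr.
set (A := c1 * x). set (B := c2 * x + c1 * y). set (D := c3 * x + c2 * y + c1 * w).
set (p := fun z => x + y * z + w * z ^ 2).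
set (q := fun z => z * (A + B * z + D * z ^ 2)).
set (H := fun z => omega z * p z + - (1) * q z).
set (s := (r ^ 2)%R).
set (K := fun z => (Cconj A * RtoC (s) * z ^ 2 + Cconj B * RtoC (s ^ 2) * z + Cconj D * RtoC
  (s ^ 3)) * (/ z * (/ z * / z))).
set (L := fun z => RtoC s * (Cconj A * (B * z + D * z ^ 2) + Cconj B * D * RtoC s * z)).
set (N := fun z => Cconj x * (y * z + w * z ^ 2) + Cconj y * w * RtoC s * z).
set (G := fun z => L z + K z * H z + - (1) * N z).
assert (HG : twice_derivable_on punctured_disk G).
{ assert (V : twice_derivable_on punctured_disk (fun z => / z)).
  { apply twice_derivable_inv; [|apply twice_derivable_id]. intros z Hz. apply Cmod_gt_0, Hz. }
  assert (O : twice_derivable_on punctured_disk omega).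
  { apply twice_derivable_sub with (2 := Hom). intros z Hz; apply Hz. }
  pose proof (twice_derivable_mult _ _ _ V (twice_derivable_mult _ _ _ V V)) as V3.
  pose proof (twice_derivable_plus _ _ _ (twice_derivable_mult _ _ _ O (twice_derivable_quadratic _ x y w))
    (twice_derivable_mult _ _ _ (twice_derivable_id _) (twice_derivable_quadratic _ (- A) (- B) (- D)))) as HH.
  pose proof (twice_derivable_mult _ _ _ (twice_derivable_mult _ _ _
    (twice_derivable_quadratic _ (Cconj D * RtoC (s ^ 3)) (Cconj B * RtoC (s ^ 2))
      (Cconj A * RtoC s)) V3) HH) as KH.
  pose proof (twice_derivable_plus _ _ _ KH (twice_derivable_quadratic _ 0
    (RtoC s * (Cconj A * B + Cconj B * D * RtoC s) - (Cconj x * y + Cconj y * w * RtoC s))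
    (RtoC s * (Cconj A * D) - Cconj x * w))) as GG.
  apply twice_derivable_ext with (2 := GG). intros z. unfold G, L, K, H, N, p, q. clear.
  generalize (/ z). intros v. clearbody A B D s.
  generalize (RtoC (s ^ 3)) (RtoC (s ^ 2)) (RtoC s). intros. ring. }
assert (HJ : jet H 0 0 0 0).
{ pose proof (jet_mult J (jet_poly x y w 0)) as J1.
  pose proof (jet_plus J1 (jet_poly 0 (- A) (- B) (- D))) as J2.
  apply (jet_ext _ H _ _ _ _ 1 Rlt_0_1) in J2.
  - apply (jet_congr _ _ _ _ _ _ _ _ _) with (5 := J2); unfold A, B, D; ring.
  - intros z _. unfold H, p, q. ring. }
assert (Lim : forall eps, (0 < eps)%R -> exists delta, (0 < delta)%R /\
     forall z, (0 < Cmod z < delta)%R -> (Cmod (G z) < eps)%R).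
{ destruct HJ as [M [d [Hd HM]]].
  set (n1 := y * Cconj x + Cconj y * w * RtoC s). set (n2 := Cconj x * w).
  set (l1 := RtoC s * (Cconj A * B + Cconj B * D * RtoC s)). set (l2 := RtoC s * (Cconj A * D)).
  set (BK := (Cmod (Cconj D * RtoC (s ^ 3)) + Cmod (Cconj B * RtoC (s ^ 2)) + Cmod
    (Cconj A * RtoC s) + Cmod 0)%R).
  set (BL := (Cmod (l1 - n1) + Cmod (l2 - n2) + Cmod 0 + Cmod 0)%R).
  assert (B0 : (0 <= BK /\ 0 <= BL)%R).
  { unfold BK, BL. split; repeat apply Rplus_le_le_0_compat; apply Cmod_ge_0. }
  intros eps He. pose proof (Rabs_pos M) as HM0.
  set (T := (BL + BK * Rabs M + 1)%R). assert (HT : (0 < T)%R) by (unfold T; nra).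
  exists (Rmin (Rmin 1 d) (eps / T)). split.
  { repeat apply Rmin_glb_lt; try lra. now apply Rdiv_lt_0_compat. }
  intros z Hz.
  pose proof (Rmin_l (Rmin 1 d) (eps / T)). pose proof (Rmin_r (Rmin 1 d) (eps / T)).
  pose proof (Rmin_l 1 d). pose proof (Rmin_r 1 d).
  assert (Hz0 : z <> 0) by (apply Cmod_gt_0; lra).
  specialize (HM z ltac:(lra)).
  replace (H z - (0 + 0 * z + 0 * z ^ 2 + 0 * z ^ 3)) with (H z) in HM by ring.
  pose proof (poly_bound (Cconj D * RtoC (s ^ 3)) (Cconj B * RtoC (s ^ 2))
    (Cconj A * RtoC s) 0 z ltac:(lra)) as PK.
  pose proof (poly_bound (l1 - n1) (l2 - n2) 0 0 z ltac:(lra)) as PL.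
  fold BK in PK. fold BL in PL.
  set (k := Cconj D * RtoC (s ^ 3) + Cconj B * RtoC (s ^ 2) * z + Cconj A * RtoC s * z ^ 2 + 0 * z ^ 3) in *.
  set (l := l1 - n1 + (l2 - n2) * z + 0 * z ^ 2 + 0 * z ^ 3) in *.
  replace (G z) with (z * l + k * (H z * / z ^ 3)).
  2: { unfold G, L, K, N, l, k, l1, l2, n1, n2. field. exact Hz0. }
  apply Rle_lt_trans with (1 := Cmod_triangle _ _). rewrite !Cmod_mult.
  rewrite Cmod_inv, Cmod_pow by (apply Cpow_nz; exact Hz0).
  set (t := Cmod z) in *.
  assert (HH : (Cmod (H z) * / t ^ 3 <= Rabs M * t)%R).
  { apply Rle_trans with (M * t ^ 4 * / t ^ 3)%R.
    - apply Rmult_le_compat_r; [|exact HM]. left. apply Rinv_0_lt_compat, pow_lt; lra.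
    - replace (M * t ^ 4 * / t ^ 3)%R with (M * t)%R by (field; lra).
      apply Rmult_le_compat_r; [lra|apply Rle_abs]. }
  assert (Cmod k * (Cmod (H z) * / t ^ 3) <= BK * (Rabs M * t))%R.
  { apply Rmult_le_compat; try apply Cmod_ge_0; auto.
    apply Rmult_le_pos; [apply Cmod_ge_0|]. left. apply Rinv_0_lt_compat, pow_lt; lra. }
  assert (t * T < eps)%R.
  { apply Rlt_le_trans with (eps / T * T)%R; [apply Rmult_lt_compat_r; lra|right; field; lra]. }
  assert (t * Cmod l <= t * BL)%R by (apply Rmult_le_compat_l; lra).
  unfold T in *. nra. }
pose proof (circle_integral_zero G r HG Lim Hr) as I0.
set (cst := (s * (Cmod A ^ 2 + Cmod B ^ 2 * s + Cmod D ^ 2 * s ^ 2)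
   - (Cmod x ^ 2 + Cmod y ^ 2 * s + Cmod w ^ 2 * s ^ 2))%R).
assert (PW : forall t, (cst + 2 * Re (G (circle_pt r t)) <= 0)%R).
{ intros t. set (z := circle_pt r t).
  assert (Hz : Cmod z = r) by (apply Cmod_circle_pt; lra).
  assert (Hz0 : z <> 0) by (apply Cmod_gt_0; lra).
  assert (EK : K z = Cconj (q z)).
  { pose proof (Cconj_on_circle z r ltac:(lra) Hz) as E. fold s in E.
    unfold K, q. rewrite !Cmult_conj, !Cplus_conj, !Cmult_conj. simpl (z ^ 2).
    rewrite !Cmult_conj, <- E.
    rewrite !RtoC_pow.
    replace (Cconj 1) with (RtoC 1) by (apply injective_projections; simpl; ring).
    field. exact Hz0. }
  assert (EQ : (Cmod (q z) ^ 2 = s * (Cmod A ^ 2 + Cmod B ^ 2 * s + Cmod D ^ 2 * s ^ 2) + 2 * Re (L z))%R).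
  { unfold q. rewrite Cmod_mult, Rpow_mult_distr, Cmod_sqr_quadratic, Hz. fold s.
    unfold L. rewrite re_scal_l. ring. }
  assert (EP : (Cmod (p z) ^ 2 = Cmod x ^ 2 + Cmod y ^ 2 * s + Cmod w ^ 2 * s ^ 2 + 2 * Re (N z))%R).
  { unfold p. rewrite Cmod_sqr_quadratic, Hz. reflexivity. }
  assert (EH : (Cmod (omega z * p z) ^ 2 = Cmod (q z) ^ 2 + Cmod (H z) ^ 2 + 2 * Re (K z * H z))%R).
  { rewrite EK, <- Cmod_sqr_plus. f_equal. f_equal. unfold H. ring. }
  assert (LE : (Cmod (omega z * p z) ^ 2 <= Cmod (p z) ^ 2)%R).
  { rewrite Cmod_mult, Rpow_mult_distr. specialize (Hb z ltac:(lra)).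
    pose proof (Cmod_ge_0 (omega z)). pose proof (pow2_ge_0 (Cmod (p z))).
    assert (Cmod (omega z) ^ 2 <= 1)%R by nra. nra. }
  pose proof (pow2_ge_0 (Cmod (H z))).
  assert (EG : Re (G z) = (Re (L z) + Re (K z * H z) - Re (N z))%R).
  { unfold G. destruct (L z), (K z * H z), (N z). unfold Re; simpl; ring. }
  unfold cst. rewrite EG. lra. }
assert (Ex : ex_RInt (fun t => Re (G (circle_pt r t))) 0 (2 * PI)).
{ apply ex_RInt_circ; [lra|]. intros z Hz. destruct HG as [G1 HG]. exists (G1 z). apply HG.
  unfold punctured_disk; lra. }
pose proof PI_RGT_0 as HPI.
assert (LE : (RInt (fun t => Re (G (circle_pt r t))) 0 (2 * PI) <= RInt (fun _ => - cst / 2) 0 (2 * PI))%R).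
{ apply RInt_le; [lra|exact Ex|apply ex_RInt_const|].
  intros t _. specialize (PW t). lra. }
rewrite I0, RInt_const in LE.
change (0 <= (2 * PI - 0) * (- cst / 2))%R in LE.
assert (cst <= 0)%R by nra. unfold cst in *. fold s. lra.
Qed.

Lemma toeplitz_contraction (omega : C -> C) (c1 c2 c3 x y w : C) :
  (forall z, (Cmod z < 1)%R -> (Cmod (omega z) < 1)%R) ->
  twice_derivable_on (fun z => (Cmod z < 1)%R) omega -> jet omega 0 c1 c2 c3 ->
  (Cmod (c1 * x) ^ 2 + Cmod (c2 * x + c1 * y) ^ 2 + Cmod (c3 * x + c2 * y + c1 * w) ^ 2
   <= Cmod x ^ 2 + Cmod y ^ 2 + Cmod w ^ 2)%R.
Proof.
intros Hb Hom J. apply Rnot_lt_le. intros Hlt.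
pose proof (fun r => toeplitz_radius omega c1 c2 c3 x y w r Hb Hom J) as T.
pose proof (pow2_ge_0 (Cmod (c1 * x))). pose proof (pow2_ge_0 (Cmod (c2 * x + c1 * y))).
pose proof (pow2_ge_0 (Cmod (c3 * x + c2 * y + c1 * w))).
pose proof (pow2_ge_0 (Cmod x)). pose proof (pow2_ge_0 (Cmod y)). pose proof (pow2_ge_0 (Cmod w)).
set (a := (Cmod (c1 * x) ^ 2)%R) in *. set (b := (Cmod (c2 * x + c1 * y) ^ 2)%R) in *.
set (c := (Cmod (c3 * x + c2 * y + c1 * w) ^ 2)%R) in *.
set (a' := (Cmod x ^ 2)%R) in *. set (b' := (Cmod y ^ 2)%R) in *. set (c' := (Cmod w ^ 2)%R) in *.
clearbody a b c a' b' c'.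
set (L := (a + b + c)%R) in *. set (S := (a' + b' + c')%R) in *.
(* With 1 - e as the radius, the weights on the left are at least 1 - 6 e, which loses
    only half of L - S. *)
set (e := ((L - S) / (12 * L))%R).
assert (HL : (0 < L)%R) by (unfold S in *; lra).
assert (He : (0 < e)%R) by (unfold e; apply Rdiv_lt_0_compat; lra).
assert (Ee : (e * L = (L - S) / 12)%R) by (unfold e; field; lra).
assert (He1 : (e <= 1 / 12)%R).
{ apply Rmult_le_reg_r with L; [exact HL|]. unfold S in *. lra. }
specialize (T (1 - e)%R ltac:(lra)).
set (s := ((1 - e) ^ 2)%R) in *.
assert (Hs : (1 - 2 * e <= s <= 1)%R) by (unfold s; nra).
assert (Hs2 : (1 - 4 * e <= s ^ 2 <= 1)%R) by nra.
assert (Hs3 : (1 - 6 * e <= s * s ^ 2 <= 1)%R) by nra.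
assert (U : (a' + b' * s + c' * s ^ 2 <= S)%R) by (unfold S; nra).
assert (V : ((s * s ^ 2) * L <= s * (a + b * s + c * s ^ 2))%R).
{ assert (s * s ^ 2 <= s)%R by nra. assert (s * s ^ 2 <= s * s)%R by nra. unfold L. nra. }
assert ((1 - 6 * e) * L <= S)%R by nra.
nra.
Qed.

(** * From the Toeplitz matrix to the bound *)

Definition toeplitz_contractive (c1 c2 c3 : C) : Prop :=
  forall x y w : C,
  (Cmod (c1 * x) ^ 2 + Cmod (c2 * x + c1 * y) ^ 2 + Cmod (c3 * x + c2 * y + c1 * w) ^ 2
   <= Cmod x ^ 2 + Cmod y ^ 2 + Cmod w ^ 2)%R.

Lemma Cmod_sqr_0_le (z : C) : (Cmod z ^ 2 <= 0)%R -> z = 0.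
Proof. intros H. apply Cmod_eq_0. pose proof (Cmod_ge_0 z). nra. Qed.

(** The choice w = conj(c1) (c3 x + c2 y) / (1 - |c1|^2) is optimal for given x and y
    (Schur complement). *)
Lemma toeplitz_reduced (c1 c2 c3 x y : C) :
  toeplitz_contractive c1 c2 c3 -> (Cmod c1 < 1)%R ->
  ((1 - Cmod c1 ^ 2) * (Cmod (c1 * x) ^ 2 + Cmod (c2 * x + c1 * y) ^ 2)
     + Cmod (c3 * x + c2 * y) ^ 2
   <= (1 - Cmod c1 ^ 2) * (Cmod x ^ 2 + Cmod y ^ 2))%R.
Proof.
intros T H1. pose proof (Cmod_ge_0 c1) as H0.
set (D := (1 - Cmod c1 ^ 2)%R). assert (HD : (0 < D)%R) by (unfold D; nra).
set (g := c3 * x + c2 * y).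
specialize (T x y (RtoC (/ D) * (Cconj c1 * g))). fold g in T.
assert (E1 : (Cmod (g + c1 * (RtoC (/ D) * (Cconj c1 * g))) ^ 2 = Cmod g ^ 2 * / D ^ 2)%R).
{ replace (g + c1 * (RtoC (/ D) * (Cconj c1 * g))) with (RtoC (/ D) * g).
  - rewrite Cmod_mult, Cmod_R, Rpow_mult_distr, pow2_abs. field; lra.
  - assert (E : c1 * Cconj c1 = RtoC (1 - D)).
    { unfold D. replace (1 - (1 - Cmod c1 ^ 2))%R with (Cmod c1 ^ 2)%R by ring. rewrite Cmod2_alt.
      destruct c1. unfold Re, Im. apply injective_projections; simpl; ring. }
    replace (c1 * (RtoC (/ D) * (Cconj c1 * g))) with ((c1 * Cconj c1) * RtoC (/ D) * g) by ring.
    rewrite E. rewrite <- RtoC_mult. replace ((1 - D) * / D)%R with (/ D - 1)%R by (field; lra).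
    rewrite RtoC_minus. ring. }
assert (E2 : (Cmod (RtoC (/ D) * (Cconj c1 * g)) ^ 2 = (1 - D) * Cmod g ^ 2 * / D ^ 2)%R).
{ rewrite !Cmod_mult, Cmod_R, !Rpow_mult_distr, pow2_abs.
  replace (Cmod (Cconj c1) ^ 2)%R with (1 - D)%R.
  - field; lra.
  - unfold D. rewrite !Cmod2_alt. unfold Re, Im; simpl; ring. }
rewrite E1, E2 in T. set (G := (Cmod g ^ 2)%R) in *.
set (u := (Cmod (c1 * x) ^ 2 + Cmod (c2 * x + c1 * y) ^ 2)%R) in *.
set (v := (Cmod x ^ 2 + Cmod y ^ 2)%R) in *.
assert (T' : (u + G * / D <= v)%R).
{ replace (G * / D)%R with (G * / D ^ 2 - (1 - D) * G * / D ^ 2)%R by (field; lra). lra. }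
replace G with (D * (G * / D))%R by (field; lra). rewrite <- Rmult_plus_distr_l.
apply Rmult_le_compat_l; lra.
Qed.

Lemma toeplitz_c1 (c1 c2 c3 : C) : toeplitz_contractive c1 c2 c3 -> (Cmod c1 <= 1)%R.
Proof.
intros T. specialize (T 0 0 1).
replace (c1 * 0) with (RtoC 0) in T by ring. replace (c2 * 0 + 0) with (RtoC 0) in T by ring.
replace (c3 * 0 + c2 * 0 + c1 * 1) with c1 in T by ring. rewrite Cmod_0, Cmod_1 in T.
pose proof (Cmod_ge_0 c1). nra.
Qed.

Lemma toeplitz_c1_one (c1 c2 c3 : C) : toeplitz_contractive c1 c2 c3 -> Cmod c1 = 1%R ->
  c2 = 0 /\ c3 = 0.
Proof.
intros T H. pose proof (T 0 1 0) as T1. pose proof (T 1 0 0) as T2.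
replace (c1 * 0) with (RtoC 0) in T1 by ring.
replace (c2 * 0 + c1 * 1) with c1 in T1 by ring.
replace (c3 * 0 + c2 * 1 + 0) with c2 in T1 by ring.
replace (c1 * 1) with c1 in T2 by ring.
replace (c2 * 1 + c1 * 0) with c2 in T2 by ring.
replace (c3 * 1 + c2 * 0 + c1 * 0) with c3 in T2 by ring.
rewrite Cmod_0, Cmod_1, H in *.
pose proof (pow2_ge_0 (Cmod c2)). pose proof (pow2_ge_0 (Cmod c3)).
split; apply Cmod_sqr_0_le; nra.
Qed.

Lemma toeplitz_c2 (c1 c2 c3 : C) :
  toeplitz_contractive c1 c2 c3 -> (Cmod c1 < 1)%R ->
  (Cmod c2 <= 1 - Cmod c1 ^ 2)%R.
Proof.
intros T H. pose proof (toeplitz_reduced _ _ _ 0 1 T H) as R.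
replace (c1 * 0) with (RtoC 0) in R by ring.
replace (c2 * 0 + c1 * 1) with c1 in R by ring.
replace (c3 * 0 + c2 * 1) with c2 in R by ring.
rewrite Cmod_0, Cmod_1 in R. pose proof (Cmod_ge_0 c1). pose proof (Cmod_ge_0 c2).
assert (0 < 1 - Cmod c1 ^ 2)%R by nra. nra.
Qed.

(** The admissible values of c3, for given c1 and c2, form a disk. For x = 1,
    [toeplitz_reduced] leaves a Hermitian inequality in y; along the ray of its linear
    term it is a real quadratic inequality whose discriminant is the claim. *)
Lemma toeplitz_c3_disk (c1 c2 c3 : C) :
  toeplitz_contractive c1 c2 c3 -> (Cmod c1 < 1)%R ->
  (Cmod (RtoC (1 - Cmod c1 ^ 2) * c3 + Cconj c1 * c2 ^ 2) <= (1 - Cmod c1 ^ 2) ^ 2 - Cmod c2 ^ 2)%R.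
Proof.
intros T H1. pose proof (toeplitz_c2 _ _ _ T H1) as H2.
pose proof (Cmod_ge_0 c1) as H10. pose proof (Cmod_ge_0 c2) as H20.
set (D := (1 - Cmod c1 ^ 2)%R) in *. assert (HD : (0 < D)%R) by (unfold D; nra).
set (E := (D ^ 2 - Cmod c2 ^ 2)%R). assert (HE : (0 <= E)%R) by (unfold E; nra).
set (A := RtoC D * Cconj c2 * c1 + Cconj c3 * c2).
set (al := (Cmod A ^ 2)%R). assert (Hal : (0 <= al)%R) by apply pow2_ge_0.
set (K := (D * Cmod c2 ^ 2 + Cmod c3 ^ 2 - D ^ 2)%R).
assert (Q : forall s : R, (K + 2 * s * al - s ^ 2 * al * E <= 0)%R).
{ intros s. pose proof (toeplitz_reduced _ _ _ 1 (RtoC s * Cconj A) T H1) as R. fold D in R.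
  enough (X : (D * (Cmod (c1 * 1) ^ 2 + Cmod (c2 * 1 + c1 * (RtoC s * Cconj A)) ^ 2)
    + Cmod (c3 * 1 + c2 * (RtoC s * Cconj A)) ^ 2 - D * (Cmod 1 ^ 2 + Cmod (RtoC s * Cconj A) ^ 2)
    = K + 2 * s * al - s ^ 2 * al * E)%R) by lra.
  assert (Y1 : (Cmod (c2 * 1 + c1 * (RtoC s * Cconj A)) ^ 2 =
     Cmod c2 ^ 2 + (1 - D) * (s ^ 2 * al) + 2 * s * Re (Cconj c2 * c1 * Cconj A))%R).
  { rewrite Cmod_sqr_plus. unfold al, D. rewrite !Cmod2_alt.
    destruct c1, c2, A. unfold Re, Im; simpl; ring. }
  assert (Y2 : (Cmod (c3 * 1 + c2 * (RtoC s * Cconj A)) ^ 2 =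
     Cmod c3 ^ 2 + Cmod c2 ^ 2 * (s ^ 2 * al) + 2 * s * Re (Cconj c3 * c2 * Cconj A))%R).
  { rewrite Cmod_sqr_plus. unfold al. rewrite !Cmod2_alt.
    destruct c3, c2, A. unfold Re, Im; simpl; ring. }
  assert (Y3 : (Cmod (RtoC s * Cconj A) ^ 2 = s ^ 2 * al)%R).
  { unfold al. rewrite !Cmod2_alt. destruct A. unfold Re, Im; simpl; ring. }
  assert (Y4 : (al = D * Re (Cconj c2 * c1 * Cconj A) + Re (Cconj c3 * c2 * Cconj A))%R).
  { unfold al. rewrite Cmod2_alt. transitivity (Re (A * Cconj A)).
    - destruct A. unfold Re, Im; simpl; ring.
    - unfold A at 1. generalize (Cconj A). intros B. destruct c1, c2, c3, B.
      unfold Re; simpl; ring. }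
  rewrite Y1, Y2, Y3, Cmod_1, Cmult_1_r.
  replace (Cmod c1 ^ 2)%R with (1 - D)%R by (unfold D; ring).
  replace (2 * s * al)%R with (2 * s * (D * Re (Cconj c2 * c1 * Cconj A) + Re (Cconj c3 * c2 * Cconj A)))%R
    by now rewrite <- Y4.
  unfold K, E. ring. }
assert (Disc : (al <= - K * E)%R).
{ destruct HE as [HE|HE].
  - specialize (Q (/ E)%R).
    replace (K + 2 * / E * al - (/ E) ^ 2 * al * E)%R with (K + al * / E)%R in Q by (field; lra).
    replace al with (al * / E * E)%R by (field; lra). apply Rmult_le_compat_r; lra.
  - rewrite <- HE in *. rewrite Rmult_0_r. apply Rnot_lt_le. intros Hp.
    specialize (Q ((1 - K) / (2 * al))%R).
    replace (K + 2 * ((1 - K) / (2 * al)) * al - ((1 - K) / (2 * al)) ^ 2 * al * 0)%R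
      with 1%R in Q by (field; lra).
    lra. }
assert (Id : (Cmod (RtoC D * c3 + Cconj c1 * c2 ^ 2) ^ 2 = E ^ 2 - (- K * E - al))%R).
{ unfold K, E, al, A.
  assert (ED : D = (1 - Re c1 ^ 2 - Im c1 ^ 2)%R) by (unfold D; rewrite Cmod2_alt; ring).
  clearbody D. rewrite !Cmod2_alt. destruct c1 as [p q], c2, c3. unfold Re, Im in *. simpl in *.
  subst D. ring. }
pose proof (Cmod_ge_0 (RtoC D * c3 + Cconj c1 * c2 ^ 2)). fold E. nra.
Qed.

Lemma toeplitz_c3 (c1 c2 c3 : C) :
  toeplitz_contractive c1 c2 c3 -> (Cmod c1 < 1)%R ->
  (Cmod c3 * (1 + Cmod c1) <= (1 - Cmod c1 ^ 2) * (1 + Cmod c1) - Cmod c2 ^ 2)%R.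
Proof.
intros T H1. pose proof (toeplitz_c3_disk _ _ _ T H1) as H.
pose proof (Cmod_ge_0 c1). pose proof (Cmod_ge_0 c3).
pose proof (Cmod_triangle_inv (RtoC (1 - Cmod c1 ^ 2) * c3) (- (Cconj c1 * c2 ^ 2))) as I.
replace (RtoC (1 - Cmod c1 ^ 2) * c3 - - (Cconj c1 * c2 ^ 2)) with (RtoC
  (1 - Cmod c1 ^ 2) * c3 + Cconj c1 * c2 ^ 2) in I by ring.
rewrite Cmod_opp, !Cmod_mult, Cmod_R, Rabs_pos_eq, Cmod_pow in I by nra.
rewrite Cmod_conj in I.
apply Rmult_le_reg_l with (1 - Cmod c1)%R; [lra|]. nra.
Qed.

(** Replacing n by its bound leaves a concave quadratic in y whose vertex is (3/4) c
    (1 + c). For c <= 2/3 the value at the vertex is good enough; for larger c the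
    vertex lies to the right of 1 - c^2, and the value at y = 1 - c^2 is decisive. *)
Lemma schwarz_moduli_bound (c y n : R) : (0 <= c < 1)%R -> (0 <= y <= 1 - c ^ 2)%R ->
  (n * (1 + c) <= (1 - c ^ 2) * (1 + c) - y ^ 2)%R ->
  (n + 3 / 2 * c * y + c ^ 3 / 12 <= 1)%R.
Proof.
intros Hc Hy Hn. apply Rmult_le_reg_r with (1 + c)%R; [lra|].
enough ((1 - c ^ 2) * (1 + c) - y ^ 2 + 3 / 2 * c * (1 + c) * y + c ^ 3 / 12 * (1 + c) <= 1 + c)%R by nra.
destruct (Rle_lt_dec c (2 / 3)) as [L|L].
- assert (A : (- y ^ 2 + 3 / 2 * c * (1 + c) * y <= 9 / 16 * c ^ 2 * (1 + c) ^ 2)%R).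
  { pose proof (pow2_ge_0 (y - 3 / 4 * c * (1 + c))). nra. }
  assert (B : (c ^ 2 * (1 + c) * (- (7 / 16) + 31 / 48 * c) <= 0)%R).
  { assert (0 <= c ^ 2 * (1 + c))%R by nra. nra. }
  nra.
- set (Y := (1 - c ^ 2)%R) in *.
  assert (A : (- y ^ 2 + 3 / 2 * c * (1 + c) * y <= - Y ^ 2 + 3 / 2 * c * (1 + c) * Y)%R).
  { assert (0 <= (Y - y) * (3 / 2 * c * (1 + c) - Y - y))%R; [|nra].
    apply Rmult_le_pos; [lra|]. unfold Y in *. nra. }
  assert (B : (5 / 2 * c * (1 - c ^ 2) + c ^ 3 / 12 <= 1)%R).
  { assert (Ht : (0 <= c - 2 / 3)%R) by lra. pose proof (pow_le _ 2 Ht).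
    pose proof (pow_le _ 3 Ht). nra. }
  assert (B' : ((5 / 2 * c * (1 - c ^ 2) + c ^ 3 / 12) * (1 + c) <= 1 * (1 + c))%R).
  { apply Rmult_le_compat_r; lra. }
  unfold Y in *. nra.
Qed.

Lemma schwarz_functional_le_1 (c1 c2 c3 : C) : toeplitz_contractive c1 c2 c3 ->
  (Cmod (c3 + 3 / 2 * c1 * c2 - / 12 * c1 ^ 3) <= 1)%R.
Proof.
intros T.
assert (N1 : Cmod (3 / 2) = (3 / 2)%R).
{ rewrite <- RtoC_div by lra. rewrite Cmod_R, Rabs_pos_eq; lra. }
assert (N2 : Cmod (/ 12) = (/ 12)%R).
{ rewrite <- RtoC_inv by lra. rewrite Cmod_R, Rabs_pos_eq; lra. }
assert (Tri : (Cmod (c3 + 3 / 2 * c1 * c2 - / 12 * c1 ^ 3)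
  <= Cmod c3 + 3 / 2 * Cmod c1 * Cmod c2 + Cmod c1 ^ 3 / 12)%R).
{ unfold Cminus. apply Rle_trans with (1 := Cmod_triangle _ _).
  rewrite Cmod_opp, Cmod_mult, N2, Cmod_pow.
  pose proof (Cmod_triangle c3 (3 / 2 * c1 * c2)) as I. rewrite !Cmod_mult, N1 in I. lra. }
apply Rle_trans with (1 := Tri).
pose proof (Cmod_ge_0 c1).
destruct (toeplitz_c1 _ _ _ T) as [L|E].
- apply schwarz_moduli_bound; [lra| |now apply toeplitz_c3].
  split; [apply Cmod_ge_0|now apply toeplitz_c2 with c3].
- destruct (toeplitz_c1_one _ _ _ T E) as [-> ->]. rewrite E, Cmod_0. lra.
Qed.

Lemma coefficient_bound (f : C -> C) (a : nat -> C) :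
  class_Ce f -> power_series_on_disk f a ->
  (Cmod (a 2%nat * a 3%nat - a 4%nat)%C <= 1 / 12)%R.
Proof.
intros Hf Ha. destruct (class_Ce_schwarz_function f a Hf Ha) as [omega [Hb [HC J]]].
pose proof (schwarz_functional_le_1 _ _ _ (fun x y w => toeplitz_contraction omega _ _ _ x y w Hb HC J)) as B.
match type of B with (Cmod ?e <= _)%R =>
  replace (a 2%nat * a 3%nat - a 4%nat) with (- (/ 12 * e)) by field end.
assert (N : Cmod (/ 12) = (/ 12)%R).
{ rewrite <- RtoC_inv by lra. rewrite Cmod_R, Rabs_pos_eq; lra. }
rewrite Cmod_opp, Cmod_mult, N. lra.
Qed.

(** * The coefficients of the extremal function *)

Lemma is_Cseries_mult (a b : nat -> C) (la lb : C) :
  is_Cseries a la -> is_Cseries b lb ->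
  ex_series (fun n => Cmod (a n)) -> ex_series (fun n => Cmod (b n)) ->
  is_Cseries (fun n => @sum_n C_AbsRing (fun k => a k * b (n - k)%nat) n) (la * lb).
Proof.
assert (Abs : forall c : nat -> C, ex_series (fun n => Cmod (c n)) ->
  ex_series (fun n => Rabs (Re (c n))) /\ ex_series (fun n => Rabs (Im (c n)))).
{ intros c Hc.
  split; apply (@ex_series_le R_AbsRing R_CompleteNormedModule) with (2 := Hc); intros n.
  - change (Rabs (Rabs (Re (c n))) <= Cmod (c n))%R. rewrite Rabs_Rabsolu. apply re_le_Cmod.
  - change (Rabs (Rabs (Im (c n))) <= Cmod (c n))%R. rewrite Rabs_Rabsolu.
    apply Rle_trans with (2 := Rmax_Cmod (c n)). apply Rmax_r. }
intros Ha Hb Aa Ab. apply is_Cseries_iff in Ha. apply is_Cseries_iff in Hb.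
destruct Ha as [Ra Ia], Hb as [Rb Ib], (Abs a Aa) as [ARa AIa], (Abs b Ab) as [ARb AIb].
apply is_Cseries_iff. rewrite re_mult, im_mult. split.
- apply is_series_ext with (fun n =>
    minus (sum_f_R0 (fun k => Re (a k) * Re (b (n - k)%nat))%R n) (sum_f_R0 (fun k => Im
      (a k) * Im (b (n - k)%nat))%R n)).
  + intros n. rewrite Re_sum_n, sum_n_Reals. change (minus ?x ?y) with (x - y)%R.
    rewrite <- minus_sum. apply sum_eq. intros k _. now rewrite re_mult.
  + apply (@is_series_minus R_AbsRing R_NormedModule).
    * exact (is_series_mult _ _ _ _ Ra Rb ARa ARb).
    * exact (is_series_mult _ _ _ _ Ia Ib AIa AIb).
- apply is_series_ext with (fun n =>
    plus (sum_f_R0 (fun k => Re (a k) * Im (b (n - k)%nat))%R n) (sum_f_R0 (fun k => Im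
      (a k) * Re (b (n - k)%nat))%R n)).
  + intros n. rewrite Im_sum_n, sum_n_Reals. change (plus ?x ?y) with (x + y)%R.
    rewrite <- plus_sum. apply sum_eq. intros k _. now rewrite im_mult.
  + apply (@is_series_plus R_AbsRing R_NormedModule).
    * exact (is_series_mult _ _ _ _ Ra Ib ARa AIb).
    * exact (is_series_mult _ _ _ _ Ia Rb AIa ARb).
Qed.

Lemma CPSeries_mult (a b : nat -> C) (rho : R) (z : C) :
  abs_conv a rho -> abs_conv b rho -> (Cmod z < rho)%R ->
  is_Cseries (fun n => @sum_n C_AbsRing (fun k => a k * b (n - k)%nat) n * z ^ n) (CPSeries a z * CPSeries b z).
Proof.
intros Ha Hb Hz.
assert (Abs : forall c, abs_conv c rho -> ex_series (fun n => Cmod (c n * z ^ n))).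
{ intros c Hc. apply ex_series_ext with (fun n => Cmod (c n) * Cmod z ^ n)%R.
  - intros n. now rewrite Cmod_mult, Cmod_pow.
  - apply Hc. split; [apply Cmod_ge_0|exact Hz]. }
apply is_Cseries_ext with (2 := is_Cseries_mult _ _ _ _ (CPSeries_correct _ _ _ Ha Hz)
  (CPSeries_correct _ _ _ Hb Hz) (Abs _ Ha) (Abs _ Hb)).
intros n. rewrite Cmult_comm.
change (@sum_n C_AbsRing (fun k => a k * z ^ k * (b (n - k)%nat * z ^ (n - k))) n
   = mult (z ^ n : C_AbsRing) (@sum_n C_AbsRing (fun k => a k * b (n - k)%nat) n)).
rewrite <- (sum_n_mult_l (K := C_AbsRing)). apply sum_n_ext_loc. intros k Hk.
change (a k * z ^ k * (b (n - k)%nat * z ^ (n - k)) = z ^ n * (a k * b (n - k)%nat)).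
assert (E : z ^ n = z ^ k * z ^ (n - k)) by (rewrite <- Cpow_add_r; f_equal; lia).
rewrite E. ring.
Qed.

(** Course-of-values recursion: row n holds the first n + 1 coefficients. *)
Fixpoint extremal_table (n : nat) : nat -> R :=
  match n with
  | O => fun _ => 1%R
  | S m => fun k =>
      if (k <=? m)%nat then extremal_table m k
      else (/ (3 * INR (S m)) * sum_f_R0 (fun i => extremal_table m i / INR (fact (S (m - i)))) m)%R
  end.

Definition extremal_coef (n : nat) : R := extremal_table n n.

Lemma extremal_table_stable (n k : nat) : (k <= n)%nat -> extremal_table n k = extremal_coef k.
Proof.
induction n as [|n IH]; intros Hk.
- now replace k with O by lia.
- destruct (Nat.eq_dec k (S n)) as [->|Hne]; [reflexivity|].
  cbn [extremal_table]. rewrite (proj2 (Nat.leb_le k n)) by lia. apply IH. lia.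
Qed.

Lemma extremal_coef_S (m : nat) :
  (INR (S m) * extremal_coef (S m) = / 3 * sum_f_R0 (fun i => extremal_coef i / INR (fact (S (m - i)))) m)%R.
Proof.
unfold extremal_coef at 1. cbn [extremal_table]. rewrite (proj2 (Nat.leb_gt (S m) m)) by lia.
rewrite (sum_eq _ (fun i => extremal_coef i / INR (fact (S (m - i))))%R).
- field. apply not_0_INR. lia.
- intros i Hi. now rewrite extremal_table_stable.
Qed.

Lemma fact_ge_pow2 (n : nat) : (2 ^ n <= INR (fact (S n)))%R.
Proof.
induction n as [|n IH]; [simpl; lra|].
rewrite fact_simpl, mult_INR. simpl pow.
apply Rmult_le_compat; try lra; [apply pow_le; lra|].
rewrite !S_INR. pose proof (pos_INR n). lra.
Qed.

(** The factorials are bounded below by powers of 2, which turns the recursion into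
    the one of (1 - u/2)^(-2/3), a function with coefficients decreasing
    geometrically. *)
Lemma extremal_coef_bound (n : nat) :
  (0 <= extremal_coef n)%R /\ (extremal_coef (S n) <= / 3 * (/ 2) ^ n)%R.
Proof.
assert (P : forall n, (0 <= extremal_coef n)%R).
{ intros k. induction k as [k IH] using lt_wf_ind.
  destruct k as [|m]; [unfold extremal_coef; simpl; lra|].
  apply Rmult_le_reg_l with (INR (S m)); [apply lt_0_INR; lia|].
  rewrite Rmult_0_r, extremal_coef_S.
  apply Rmult_le_pos; [lra|].
  apply Rle_trans with (sum_f_R0 (fun _ => 0%R) m); [rewrite sum_cte; lra|].
  apply sum_Rle. intros i Hi.
  apply Rmult_le_pos; [apply IH; lia|]. left; apply Rinv_0_lt_compat, INR_fact_lt_0. }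
split; [apply P|].
induction n as [n IH] using lt_wf_ind.
apply Rmult_le_reg_l with (INR (S n)); [apply lt_0_INR; lia|]. rewrite extremal_coef_S.
set (B := fun i : nat => match i with O => (/ 2) ^ n | S _ => 2 / 3 * (/ 2) ^ n end%R).
assert (HB : forall m, (sum_f_R0 B m = (/ 2) ^ n * (1 + 2 / 3 * INR m))%R).
{ induction m as [|m IHm]; [simpl; ring|]. rewrite tech5, IHm, S_INR. unfold B. ring. }
assert (L : (sum_f_R0 (fun i => extremal_coef i / INR (fact (S (n - i)))) n <= sum_f_R0 B n)%R).
{ apply sum_Rle. intros i Hi.
  assert (F : (/ INR (fact (S (n - i))) <= (/ 2) ^ (n - i))%R).
  { rewrite pow_inv. apply Rinv_le_contravar; [apply pow_lt; lra|apply fact_ge_pow2]. }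
  assert (F0 : (0 < / INR (fact (S (n - i))))%R) by apply Rinv_0_lt_compat, INR_fact_lt_0.
  unfold Rdiv. destruct i as [|i].
  - unfold B. rewrite Nat.sub_0_r in *. unfold extremal_coef; simpl extremal_table. lra.
  - unfold B. apply Rle_trans with (/ 3 * (/ 2) ^ i * (/ 2) ^ (n - S i))%R.
    + apply Rmult_le_compat; [apply P|lra|apply IH; lia|exact F].
    + rewrite Rmult_assoc, <- pow_add. right.
      replace n with (S (i + (n - S i)))%nat at 2 by lia. simpl pow. field. }
rewrite HB in L. rewrite S_INR.
pose proof (pow_lt (/ 2) n ltac:(lra)). pose proof (pos_INR n). nra.
Qed.

(** * The extremal function *)

Lemma abs_conv_of_bound (a : nat -> C) (M rho : R) : (0 < rho)%R ->
  (forall n, (Cmod (a n) <= M * (/ rho) ^ n)%R) -> abs_conv a rho.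
Proof.
intros Hr H s Hs.
apply (@ex_series_le R_AbsRing R_CompleteNormedModule) with (fun n => M * (s / rho) ^ n)%R.
- intros n. change (Rabs (Cmod (a n) * s ^ n) <= M * (s / rho) ^ n)%R.
  pose proof (pow_le s n (proj1 Hs)).
  rewrite Rabs_pos_eq by (apply Rmult_le_pos; [apply Cmod_ge_0|assumption]).
  unfold Rdiv. rewrite Rpow_mult_distr.
  replace (M * (s ^ n * (/ rho) ^ n))%R with (M * (/ rho) ^ n * s ^ n)%R by ring.
  apply Rmult_le_compat_r; auto.
- apply (@ex_series_scal R_AbsRing R_NormedModule). apply ex_series_geom.
  rewrite Rabs_pos_eq; [|apply Rmult_le_pos; [lra|left; now apply Rinv_0_lt_compat]].
  apply Rmult_lt_reg_r with rho; [exact Hr|]. unfold Rdiv. rewrite Rmult_assoc, Rinv_l; lra.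
Qed.

Definition extremal_D_coef (n : nat) : C := RtoC (extremal_coef n).
Definition extremal_Phi_coef (n : nat) : C := RtoC (extremal_coef n / INR (3 * n + 1)).

Lemma extremal_coef_le (n : nat) : (extremal_coef n <= 1 * (/ 2) ^ n)%R.
Proof.
destruct n as [|n]; [unfold extremal_coef; simpl; lra|].
pose proof (proj2 (extremal_coef_bound n)). pose proof (pow_lt (/ 2) n ltac:(lra)). simpl pow.
lra.
Qed.

Lemma extremal_D_abs : abs_conv extremal_D_coef 2.
Proof.
apply abs_conv_of_bound with 1%R; [lra|]. intros n. unfold extremal_D_coef.
rewrite Cmod_R, Rabs_pos_eq; [apply extremal_coef_le|apply extremal_coef_bound].
Qed.

Lemma extremal_Phi_abs : abs_conv extremal_Phi_coef 2.
Proof.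
apply abs_conv_of_bound with 1%R; [lra|]. intros n. unfold extremal_Phi_coef.
pose proof (extremal_coef_le n). pose proof (proj1 (extremal_coef_bound n)).
assert (E : (1 <= INR (3 * n + 1))%R) by (rewrite plus_INR; simpl (INR 1); pose proof (pos_INR (3 * n)); lra).
assert (I : (0 < / INR (3 * n + 1) <= 1)%R).
{ split; [apply Rinv_0_lt_compat; lra|]. rewrite <- Rinv_1. apply Rinv_le_contravar; lra. }
rewrite Cmod_R, Rabs_pos_eq; unfold Rdiv; nra.
Qed.

(** The derivative of the extremal function is this power series at z^3. *)
Definition extremal_D : C -> C := CPSeries extremal_D_coef.
(** The extremal function is z times this power series at z^3; its coefficients are
    those that integrate the series of D(z^3) termwise. *)
Definition extremal_Phi : C -> C := CPSeries extremal_Phi_coef.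

(** The recursion for the coefficients says that D' is a third of the Cauchy product
    of D with (e^u - 1)/u. *)
Lemma extremal_D_ode (u : C) : (Cmod u < 2)%R ->
  3 * u * CPSeries (coef_derive extremal_D_coef) u = extremal_D u * (Cexp u - 1).
Proof.
intros Hu.
pose proof (exp_coef_abs 2) as Ae.
assert (E : CPSeries (coef_derive extremal_D_coef) u = / 3 * (extremal_D u * CPSeries
  (fun n => exp_coef (S n)) u)).
{ apply CPSeries_eq.
  apply is_Cseries_ext with (2 := is_Cseries_scal (/ 3) _ _
    (CPSeries_mult _ _ _ u extremal_D_abs (abs_conv_shift _ _ Ae) Hu)).
  intros n. rewrite Cmult_assoc. f_equal. unfold coef_derive, extremal_D_coef.
  rewrite <- RtoC_mult, extremal_coef_S, RtoC_mult, <- RtoC_inv by lra. f_equal.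
  apply injective_projections.
  - change (Re (@sum_n C_AbsRing (fun k => RtoC (extremal_coef k) * exp_coef (S (n - k))) n)
      = sum_f_R0 (fun i => extremal_coef i / INR (fact (S (n - i))))%R n).
    rewrite Re_sum_n, sum_n_Reals. apply sum_eq. intros i _. unfold exp_coef. rewrite re_scal_l.
    reflexivity.
  - change (Im (@sum_n C_AbsRing (fun k => RtoC (extremal_coef k) * exp_coef (S (n - k))) n) = 0%R).
    rewrite Im_sum_n, sum_n_Reals. rewrite (sum_eq _ (fun _ => 0%R)).
    + rewrite sum_cte. ring.
    + intros i _. unfold exp_coef. rewrite <- RtoC_mult. reflexivity. }
rewrite E, Cexp_Csum, (CPSeries_step _ _ u Ae Hu).
replace (exp_coef 0) with (RtoC 1) by (unfold exp_coef; simpl; now rewrite Rinv_1).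
field.
Qed.

Lemma extremal_D_near_1 (u : C) : (Cmod u <= 1)%R -> (Cmod (extremal_D u - 1) <= 2 / 3)%R.
Proof.
intros Hu.
pose proof (CPSeries_correct _ _ u extremal_D_abs ltac:(lra)) as S1. fold (extremal_D u) in S1.
pose proof (is_Cseries_tail _ _ S1) as S2. cbv beta in S2.
replace (extremal_D_coef 0 * u ^ 0) with (RtoC 1) in S2 by (unfold extremal_D_coef, extremal_coef; simpl; ring).
apply is_Cseries_norm_le with (1 := S2) (v := fun n => (/ 3 * (/ 2) ^ n)%R).
- replace (2 / 3)%R with (/ 3 * / (1 - / 2))%R by field.
  apply (@is_series_scal R_AbsRing R_NormedModule). apply is_series_geom.
  rewrite Rabs_pos_eq; lra.
- intros n. rewrite Cmod_mult, Cmod_pow. unfold extremal_D_coef. rewrite Cmod_R.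
  rewrite Rabs_pos_eq by apply extremal_coef_bound.
  rewrite <- (Rmult_1_r (/ 3 * (/ 2) ^ n)).
  apply Rmult_le_compat; [apply extremal_coef_bound|apply pow_le, Cmod_ge_0|apply extremal_coef_bound|].
  rewrite <- (pow1 (S n)). apply pow_incr. split; [apply Cmod_ge_0|exact Hu].
Qed.

Lemma extremal_Phi_ode (u : C) : (Cmod u < 2)%R ->
  extremal_Phi u + 3 * u * CPSeries (coef_derive extremal_Phi_coef) u = extremal_D u.
Proof.
intros Hu. symmetry. apply CPSeries_eq.
pose proof (CPSeries_correct _ _ u extremal_Phi_abs Hu) as S1.
pose proof (CPSeries_correct _ _ u (abs_conv_derive _ _ extremal_Phi_abs) Hu) as S2.
pose proof (is_Cseries_shift (fun n => match n
  with O => RtoC 0 | S m => coef_derive extremal_Phi_coef m * u ^ m end) _ S2) as S3.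
replace (3 * u * CPSeries (coef_derive extremal_Phi_coef) u)
  with (3 * u * (0 + CPSeries (coef_derive extremal_Phi_coef) u)) by ring.
apply is_Cseries_ext with (2 := is_Cseries_plus _ _ _ _ S1 (is_Cseries_scal (3 * u) _ _ S3)).
intros n. destruct n as [|m].
- unfold extremal_Phi_coef, extremal_D_coef. simpl. rewrite Rdiv_1_r. ring.
- unfold coef_derive, extremal_Phi_coef, extremal_D_coef.
  rewrite Cpow_S.
  replace (extremal_coef (S m)) with (extremal_coef (S m) / INR (3 * S m + 1) + 3 * INR (S m) *
    (extremal_coef (S m) / INR (3 * S m + 1)))%R at 3.
  + rewrite RtoC_plus, !RtoC_mult. ring.
  + rewrite plus_INR, mult_INR. simpl (INR 1). simpl (INR 3). field.
    pose proof (pos_INR (S m)). lra.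
Qed.

Definition extremal_f (z : C) : C := z * extremal_Phi (z ^ 3).

Lemma Cmod_cube_lt (z : C) : (Cmod z < 1)%R -> (Cmod (z ^ 3) < 1)%R.
Proof.
intros H. rewrite Cmod_pow. pose proof (Cmod_ge_0 z). simpl. nra.
Qed.

Lemma cube_derive (z : C) : is_Cderive (fun w => w ^ 3) z (3 * z ^ 2).
Proof.
apply is_Cderive_congr with (1 * (z * (z * 1)) + z * (1 * (z * 1) + z * (1 * 1 + z * 0))); [ring|].
apply (is_Cderive_mult (fun w => w) (fun w => w * (w * 1))); [apply is_Cderive_id|].
apply (is_Cderive_mult (fun w => w) (fun w => w * 1)); [apply is_Cderive_id|].
apply (is_Cderive_mult (fun w => w) (fun w => 1)); [apply is_Cderive_id|apply is_Cderive_const].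
Qed.

Lemma extremal_f_derive (z : C) : (Cmod z < 1)%R -> is_Cderive extremal_f z (extremal_D (z ^ 3)).
Proof.
intros Hz. pose proof (Cmod_cube_lt z Hz) as H3.
rewrite <- extremal_Phi_ode by lra.
apply is_Cderive_congr with (1 * extremal_Phi (z ^ 3) + z * (3 * z ^ 2 * CPSeries
  (coef_derive extremal_Phi_coef) (z ^ 3))); [ring|].
apply (is_Cderive_mult (fun w => w) (fun w => extremal_Phi (w ^ 3))); [apply is_Cderive_id|].
apply (is_Cderive_comp extremal_Phi (fun w => w ^ 3)); [|apply cube_derive].
apply (CPSeries_derive _ 2); [apply extremal_Phi_abs|lra].
Qed.

Lemma extremal_f_derive2 (z : C) : (Cmod z < 1)%R ->
  is_Cderive (fun w => extremal_D (w ^ 3)) z (3 * z ^ 2 * CPSeries (coef_derive extremal_D_coef) (z ^ 3)).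
Proof.
intros Hz. pose proof (Cmod_cube_lt z Hz) as H3.
apply (is_Cderive_comp extremal_D (fun w => w ^ 3)); [|apply cube_derive].
apply (CPSeries_derive _ 2); [apply extremal_D_abs|lra].
Qed.

(** Noshiro-Warschawski: on the segment from w to z, the real part of conj(z - w) f
    has derivative |z - w|^2 Re f' > 0, so f takes distinct values at the ends. *)
Lemma univalent_of_Re_derive_pos (f f' : C -> C) :
  (forall z, (Cmod z < 1)%R -> is_Cderive f z (f' z)) ->
  (forall z, (Cmod z < 1)%R -> (0 < Re (f' z))%R) ->
  univalent_on_disk f.
Proof.
intros Hd Hp z w Hz Hw E. unfold in_disk in *.
destruct (Ceq_dec z w) as [|Hne]; [assumption|exfalso].
set (del := z - w). assert (Hdel : del <> 0) by now apply Cminus_eq_contra.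
set (g := fun t : R => (Re w + t * Re del, Im w + t * Im del)%R : C).
assert (Hg : forall t, (0 <= t <= 1)%R -> (Cmod (g t) < 1)%R).
{ intros t Ht. replace (g t) with (RtoC (1 - t) * w + RtoC t * z).
  2: { unfold g, del, Re, Im. apply injective_projections; simpl; ring. }
  apply Rle_lt_trans with (1 := Cmod_triangle _ _).
  rewrite !Cmod_mult, !Cmod_R, !Rabs_pos_eq by lra.
  pose proof (Cmod_ge_0 w). pose proof (Cmod_ge_0 z). destruct (Req_dec t 0) as [->|]; nra. }
set (u := fun t => Re (Cconj del * f (g t))).
assert (Du : forall t, (0 <= t <= 1)%R -> is_derive u t (Cmod del ^ 2 * Re (f' (g t)))%R).
{ intros t Ht.
  replace (Cmod del ^ 2 * Re (f' (g t)))%R with (Re ((Cconj del * f' (g t)) * (Re del, Im del))).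
  2: { rewrite Cmod2_alt. destruct (f' (g t)). unfold Re, Im; simpl; ring. }
  apply (derive_along_curve (fun v => Cconj del * f v) (fun t => Re w + t * Re del)%R
    (fun t => Im w + t * Im del)%R).
  - auto_derive; auto. unfold del, Re; simpl; ring.
  - auto_derive; auto. unfold del, Im; simpl; ring.
  - apply is_Cderive_congr with (0 * f (g t) + Cconj del * f' (g t)); [ring|].
    apply (is_Cderive_mult (fun _ => Cconj del) f); [apply is_Cderive_const|now apply Hd, Hg]. }
destruct (MVT_gen u 0 1 (fun t => Cmod del ^ 2 * Re (f' (g t)))%R) as [c [Hc M]].
- intros t Ht. rewrite Rmin_left, Rmax_right in Ht by lra. apply Du; lra.
- intros t Ht. rewrite Rmin_left, Rmax_right in Ht by lra.
  apply continuity_pt_filterlim, (ex_derive_continuous (V := R_NormedModule) u).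
  eexists; apply Du; lra.
- rewrite Rmin_left, Rmax_right in Hc by lra.
  assert (G0 : g 0%R = w) by (unfold g, Re, Im; apply injective_projections; simpl; ring).
  assert (G1 : g 1%R = z) by (unfold g, del, Re, Im; apply injective_projections; simpl; ring).
  unfold u in M. rewrite G0, G1, E in M.
  pose proof (Hp (g c) (Hg c ltac:(lra))). pose proof (proj1 (Cmod_gt_0 del) Hdel).
  assert (0 < Cmod del ^ 2 * Re (f' (g c)))%R by (apply Rmult_lt_0_compat; [nra|assumption]). lra.
Qed.

Lemma extremal_class_Ce : class_Ce extremal_f.
Proof.
assert (NZ : forall z, (Cmod z < 1)%R -> (0 < Re (extremal_D (z ^ 3)))%R).
{ intros z Hz. pose proof (Cmod_cube_lt z Hz).
  pose proof (extremal_D_near_1 (z ^ 3) ltac:(lra)) as B.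
  pose proof (re_le_Cmod (extremal_D (z ^ 3) - 1)) as B2.
  replace (Re (extremal_D (z ^ 3) - 1)) with (Re (extremal_D (z ^ 3)) - 1)%R in B2 by (unfold Re; simpl; ring).
  pose proof (Rle_trans _ _ _ B2 B) as B3. apply Rabs_le_between in B3. lra. }
assert (F1 : forall z, (Cmod z < 1)%R -> C_derive extremal_f z = extremal_D (z ^ 3)).
{ intros z Hz. apply is_C_derive_unique. now apply extremal_f_derive. }
split; [split; [|split; [|split]]|].
- intros z Hz. eexists. now apply extremal_f_derive.
- apply univalent_of_Re_derive_pos with (2 := NZ). apply extremal_f_derive.
- unfold extremal_f. ring.
- rewrite F1 by (rewrite Cmod_0; lra).
  unfold extremal_D. replace (0 ^ 3) with (RtoC 0) by ring.
  rewrite (CPSeries_0 _ 2 extremal_D_abs); [reflexivity|lra].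
- exists (fun z => z ^ 3). split; [|split; [|split]].
  + intros z _. eexists. apply cube_derive.
  + intros z Hz. now apply Cmod_cube_lt.
  + ring.
  + intros z Hz. unfold in_disk in Hz.
    assert (F2 : C_derive (C_derive extremal_f) z = 3 * z ^ 2 * CPSeries (coef_derive extremal_D_coef) (z ^ 3)).
    { apply is_C_derive_unique.
      apply (is_Cderive_ext_loc (fun w => extremal_D (w ^ 3)) _ _ _
        (1 - Cmod z)); [lra| |now apply extremal_f_derive2].
      intros w Hw. symmetry. apply F1. pose proof (Cmod_triangle_inv w z). lra. }
    rewrite F1, F2 by exact Hz.
    assert (D0 : extremal_D (z ^ 3) <> 0).
    { intros E. pose proof (NZ z Hz) as P. rewrite E in P. unfold Re in P; simpl in P. lra. }
    pose proof (Cmod_cube_lt z Hz).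
    pose proof (extremal_D_ode (z ^ 3) ltac:(lra)) as O.
    replace (z * (3 * z ^ 2 * CPSeries (coef_derive extremal_D_coef) (z ^ 3)))
      with (3 * z ^ 3 * CPSeries (coef_derive extremal_D_coef) (z ^ 3)) by ring.
    rewrite O. field. exact D0.
Qed.

Definition extremal_a (n : nat) : C :=
  match n with
  | O => 0
  | S m => if (m mod 3 =? 0)%nat then extremal_Phi_coef (m / 3) else 0
  end.

(** Only the indices 3k + 1 contribute, so the partial sums of the expansion of f are
    those of Phi at z^3, each repeated three times. *)
Lemma extremal_a_partial (z : C) (n : nat) :
  @sum_n C_AbsRing (fun k => extremal_a k * z ^ k) (S n) =
  @sum_n C_AbsRing (fun k => z * (extremal_Phi_coef k * (z ^ 3) ^ k)) (n / 3).
Proof.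
induction n as [|n IH].
- rewrite sum_Sn, !sum_O.
  change (extremal_a 0 * z ^ 0 + extremal_a 1 * z ^ 1 = z * (extremal_Phi_coef 0 * (z ^ 3) ^ 0)).
  unfold extremal_a. simpl. ring.
- rewrite sum_Sn, IH.
  pose proof (Nat.div_mod_eq n 3) as E. pose proof (Nat.mod_upper_bound n 3 ltac:(lia)) as B.
  pose proof (Nat.div_mod_eq (S n) 3) as E'.
  pose proof (Nat.mod_upper_bound (S n) 3 ltac:(lia)) as B'.
  cbn [extremal_a]. destruct (Nat.eqb_spec (S n mod 3) 0) as [Z|Z].
  + assert (Q : (S n / 3 = S (n / 3))%nat) by lia. rewrite Q, sum_Sn. f_equal.
    rewrite <- Cpow_mult_r. replace (S (S n)) with (S (3 * S (n / 3)))%nat by lia.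
    rewrite Cpow_S. ring.
  + assert (Q : (S n / 3 = n / 3)%nat) by lia. rewrite Q.
    match goal with |- plus ?s _ = _ => change (s + 0 * z ^ S (S n) = s) end. ring.
Qed.

Lemma extremal_power_series : power_series_on_disk extremal_f extremal_a.
Proof.
intros z Hz. apply is_Cseries_of_pseries. pose proof (Cmod_cube_lt z Hz).
pose proof (is_Cseries_scal z _ _ (CPSeries_correct _ _ (z ^ 3) extremal_Phi_abs ltac:(lra))) as S1.
apply filterlim_locally. intros eps.
destruct (proj1 (filterlim_locally _ _) S1 eps) as [N K].
exists (S (3 * N)). intros [|n] Hn; [lia|].
pose proof (extremal_a_partial z n) as P.
change (ball (extremal_f z : C_NormedModule) eps (@sum_n C_AbsRing
  (fun k => extremal_a k * z ^ k) (S n) : C_NormedModule)).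
rewrite P. apply K. apply Nat.div_le_lower_bound; lia.
Qed.

Lemma coefficient_bound_attained : exists (f : C -> C) (a : nat -> C),
     class_Ce f /\ power_series_on_disk f a /\
     Cmod (a 2%nat * a 3%nat - a 4%nat)%C = (1 / 12)%R.
Proof.
exists extremal_f, extremal_a.
split; [apply extremal_class_Ce|split; [apply extremal_power_series|]].
assert (D1 : extremal_coef 1 = (/ 3)%R).
{ pose proof (extremal_coef_S 0) as E. unfold extremal_coef at 2 in E. simpl in E. lra. }
replace (extremal_a 2 * extremal_a 3 - extremal_a 4) with (- RtoC (1 / 12)).
- rewrite Cmod_opp, Cmod_R, Rabs_pos_eq; lra.
- unfold extremal_a. simpl Nat.modulo. simpl Nat.eqb. cbv iota. simpl Nat.div.
  unfold extremal_Phi_coef. rewrite D1. replace (INR (3 * 1 + 1)) with 4%R by (simpl; ring).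
  replace (/ 3 / 4)%R with (1 / 12)%R by field. ring.
Qed.

Local Close Scope C_scope.
Local Close Scope R_scope.

Theorem theorem5p2 :
  (forall (f : C -> C) (a : nat -> C),
     class_Ce f -> power_series_on_disk f a ->
     (Cmod (a 2%nat * a 3%nat - a 4%nat)%C <= 1 / 12)%R) /\
  (exists (f : C -> C) (a : nat -> C),
     class_Ce f /\ power_series_on_disk f a /\
     Cmod (a 2%nat * a 3%nat - a 4%nat)%C = (1 / 12)%R).
Proof.
split; [exact coefficient_bound|exact coefficient_bound_attained].
Qed.
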